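(* Consider the distributed cooperative multi-agent multi-armed bandit problem under the constrained reward model with sub-Gaussian rewards, in which all agents use the coop-UCB2-selective-learning algorithm with parameters $\sigma_g>0$, $\gamma>1$, $\eta\in(0,4)$ and increasing sublogarithmic function $f$. Then for every arm $i\in\{1,\dots,N\}$ the number of times arm $i$ is incorrectly selected by all agents until time $T$ satisfies $$\sum_{k\ne k^i}\mathbb E[\bar n_i^k(T)]\le\frac{4\sigma_g^2\gamma}{\Delta_{\min}^2G(\eta)}\left(1+\sqrt{1+\frac{\Delta_{\min}^2MG(\eta)}{2\sigma_g^2\gamma}\frac{f(T)}{\ln T}}\right)\ln T+\bar L,$$ where $$\bar L=\bar L(\epsilon_n,\epsilon_c^1,\dots,\epsilon_c^M)=\sum_{k=1}^M(t_k^\dagger-1)+M(1+\epsilon_n)+1+\frac{2M(N+1)}{\ln(1+\eta)}\left(\frac{1}{(\gamma-1)^2}+\frac{\gamma\ln\big((1+\epsilon_n)(1+\eta)\big)}{\gamma-1}+1\right)$$ is a constant independent of $T$, and $t_k^\dagger=f^{-1}(\epsilon_c^k)$.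
   Context: There are $M$ agents and $N$ arms, $M\le N$. The agents are the nodes of a connected undirected graph $\mathcal G$ with Laplacian $L_{\mathcal G}\in\mathbb R^{M\times M}$ and maximum degree $d_{\max}$. Set $P=I_M-\frac{\kappa}{d_{\max}}L_{\mathcal G}$ with $\kappa\in(0,1]$. The eigenvalues of $P$ are $\lambda_1=1>\lambda_2\ge\dots\ge\lambda_M>-1$ (standing assumption), with corresponding orthonormal eigenvectors $\mathbf u_1,\dots,\mathbf u_M$, $\mathbf u_1=\mathbf 1_M/\sqrt M$; $u_p^d$ denotes the $d$-th entry of $\mathbf u_p$. At each time $t=1,\dots,T$ agent $k$ selects one arm $i^k(t)$; $\xi_i^k(t)=1$ if $i^k(t)=i$ and $0$ otherwise. $r_i^k(t)$ is the realized reward at arm $i$ for agent $k$ at time $t$. For each $i$ and $k$, $\{r_i^k(t)\}_t$ is i.i.d. sub-Gaussian with mean $m_i$; rewards of different agents are independent and identically distributed for a given arm, and rewards at time $t$ are independent of all measurements before time $t$. A real random variable $X$ with mean $m$ is sub-Gaussian (with parameter $\sigma_g>0$) if $\ln\mathbb E[\exp(\beta X)]\le m\beta+\frac{\sigma_g^2\beta^2}{2}$ for all $\beta\in\mathbb R$. Constrained reward model: agent $k$ receives $r_{i^k(t)}^k(t)$ at time $t$ only if it is the only agent selecting arm $i^k(t)$ at time $t$, and otherwise receives no reward; however, agents still observe the value of the reward $r_{i^k(t)}^k(t)$ that they did not receive and use it in updating their estimates. The arm means are distinct: $m_{b^1}>m_{b^2}>\dots>m_{b^N}$ where $(b^1,\dots,b^N)$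 is a permutation of the arms; $\mathcal O_j^*=\{b^1,\dots,b^j\}$; $\Delta_{\min}=\min\{|m_i-m_j|: i\ne j\}$. Agent $k$ has preassigned rank $k$ and targets the $k$-th best arm $b^k$. For $i=b^k\in\mathcal O_M^*$ set $k^i=k$; for $i\notin\mathcal O_M^*$ set $k^i=0$. A selection of arm $i\in\mathcal O_M^*$ is incorrect if made by an agent $k\ne k^i$; any selection of an arm $i\notin\mathcal O_M^*$ is incorrect. $\bar n_i^k(t)$ is the number of incorrect selections of arm $i$ by agent $k$ until time $t$. The sum $\sum_{k\ne k^i}$ is over agents $k\in\{1,\dots,M\}$ with $k\ne k^i$. Cooperative estimation: $\hat{\mathbf n}_i(t)=P(\hat{\mathbf n}_i(t-1)+\boldsymbol\xi_i(t))$, $\hat{\mathbf s}_i(t)=P(\hat{\mathbf s}_i(t-1)+\mathbf r_i(t))$, $\hat{\mathbf n}_i(0)=\hat{\mathbf s}_i(0)=0$, $\hat\mu_i^k(t)=\hat s_i^k(t)/\hat n_i^k(t)$, where $\hat{\mathbf n}_i,\hat{\mathbf s}_i,\boldsymbol\xi_i,\mathbf r_i$ are the vectors over $k\in\{1,\dots,M\}$ with entries $\hat n_i^k,\hat s_i^k,\xi_i^k,r_i^k\xi_i^k$. coop-UCB2-selective-learning algorithm: for $t\le N$ agents sample in round-robin fashion, agent $k$ selecting arm $(t-1+k)\bmod N$ (residue $0$ meaning arm $N$). For $t>N$, with $$C_i^k(t-1)=\sigma_g\sqrt{\frac{2\gamma}{G(\eta)}\cdot\frac{\hat n_i^k(t-1)+f(t-1)}{M\hat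 n_i^k(t-1)}\cdot\frac{\ln(t-1)}{\hat n_i^k(t-1)}},\qquad G(\eta)=1-\frac{\eta^2}{16},$$ each agent $k$ forms the set $\mathcal O_k(t)$ of the $k$ arms with the $k$ highest values of $Q_i^k(t-1)=\hat\mu_i^k(t-1)+C_i^k(t-1)$, $i\in\{1,\dots,N\}$, and then selects an arm in $\mathcal O_k(t)$ minimizing $W_i^k(t-1)=\hat\mu_i^k(t-1)-C_i^k(t-1)$ over $i\in\mathcal O_k(t)$. The estimates are updated at each time with the cooperative estimation algorithm. Here $f$ is increasing and sublogarithmic ($f(t)/\ln t\to0$), and $f^{-1}$ is its inverse (the notation presupposes that each $\epsilon_c^k$ lies in the range of $f$). The graph explore-exploit index is $$\epsilon_n=\sqrt M\sum_{p=2}^M\frac{|\lambda_p|}{1-|\lambda_p|}.$$ The nodal explore-exploit centrality index of node $k$ is $$\epsilon_c^k=M\sum_{p=1}^M\sum_{j=2}^M\frac{|\lambda_p\lambda_j|}{1-|\lambda_p\lambda_j|}a_{pj}(k),$$ where $a_{pj}(k)=\nu_{pj}^{\text{+sum}}u_p^ku_j^k$ if $\lambda_p\lambda_j\ge0$ and $u_p^ku_j^k\ge0$; $a_{pj}(k)=\nu_{pj}^{\text{-sum}}u_p^ku_j^k$ if $\lambda_p\lambda_j\ge0$ and $u_p^ku_j^k\le0$; $a_{pj}(k)=\nu_{pj}^{\max}|u_p^ku_j^k|$ if $\lambda_p\lambda_j<0$; with $\nu_{pj}^{\text{+sum}}=\sum_{d=1}^Mu_p^du_j^d\,\mathds 1(u_p^du_j^d\ge0)$,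 $\nu_{pj}^{\text{-sum}}=\sum_{d=1}^Mu_p^du_j^d\,\mathds 1(u_p^du_j^d\le0)$, $\nu_{pj}^{\max}=\max\{|\nu_{pj}^{\text{-sum}}|,\nu_{pj}^{\text{+sum}}\}$, where $\mathds 1(\cdot)$ is the indicator function. *)

(* Defs.v *)
From mathcomp Require Export all_boot all_order all_fingroup all_algebra.
From mathcomp Require Export all_classical all_reals all_analysis.

Set Implicit Arguments.
Unset Strict Implicit.
Unset Printing Implicit Defensive.

Export Order.TTheory GRing.Theory Num.Theory.
Export numFieldNormedType.Exports.

Global Open Scope classical_set_scope.
Global Open Scope ring_scope.

(* Agents are 'I_M, arms are 'I_N and eigenvalue indices are 'I_M, all numbered
   from 0: ordinal k stands for agent k.+1, and so on.  Times are natural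
   numbers; only t >= 1 is meaningful, time 0 being the initial state of the
   estimators. *)

(** Communication graph *)

Definition simple_graph (M : nat) (e : rel 'I_M) : Prop :=
  symmetric e /\ irreflexive e.

Definition connected_graph (M : nat) (e : rel 'I_M) : Prop :=
  forall k l, connect e k l.

Definition degree (M : nat) (e : rel 'I_M) (k : 'I_M) : nat := #|[set l | e k l]%SET|.

Definition max_degree (M : nat) (e : rel 'I_M) : nat := (\max_(k < M) degree e k)%N.

Definition laplacian (R : realType) (M : nat) (e : rel 'I_M) : 'M[R]_M :=
  \matrix_(k, l) ((degree e k)%:R *+ (k == l) - (e k l)%:R).

(* A graph on a single node has maximum degree 0 and Laplacian 0; the
   convention x / 0 = 0 then gives the 1 x 1 identity. *)
Definition consensus_matrix (R : realType) (M : nat) (e : rel 'I_M) (kappa : R) :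
    'M[R]_M :=
  1%:M - (kappa / (max_degree e)%:R) *: laplacian R e.

(* [lam p], [u p] is the p.+1-th eigenpair; [u] is an orthonormal basis, so that
   [lam] lists the whole spectrum with multiplicities. *)
Record consensus_spectrum (R : realType) (M : nat) (Pm : 'M[R]_M)
    (lam : 'I_M -> R) (u : 'I_M -> 'cV[R]_M) : Prop := ConsensusSpectrum {
  spectrum_eigen : forall p, Pm *m u p = lam p *: u p;
  spectrum_orthonormal : forall p q, \sum_(d < M) u p d 0 * u q d 0 = (p == q)%:R;
  spectrum_sorted : forall p q : 'I_M, (p <= q)%N -> lam q <= lam p;
  spectrum_first : forall p : 'I_M, val p = 0%N ->
    lam p = 1 /\ u p = const_mx (Num.sqrt M%:R)^-1;
  spectrum_other : forall p : 'I_M, (0 < p)%N -> -1 < lam p < 1 }.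

(** Explore-exploit indices *)

Definition eps_n (R : realType) (M : nat) (lam : 'I_M -> R) : R :=
  Num.sqrt M%:R * \sum_(p < M | (0 < p)%N) `|lam p| / (1 - `|lam p|).

Definition nu_plus (R : realType) (M : nat) (u : 'I_M -> 'cV[R]_M) (p j : 'I_M) : R :=
  \sum_(d < M | 0 <= u p d 0 * u j d 0) u p d 0 * u j d 0.

Definition nu_minus (R : realType) (M : nat) (u : 'I_M -> 'cV[R]_M) (p j : 'I_M) : R :=
  \sum_(d < M | u p d 0 * u j d 0 <= 0) u p d 0 * u j d 0.

Definition nu_max (R : realType) (M : nat) (u : 'I_M -> 'cV[R]_M) (p j : 'I_M) : R :=
  Num.max `|nu_minus u p j| (nu_plus u p j).

(* The first two cases overlap only when the product of entries is 0, where both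
   give 0. *)
Definition a_coef (R : realType) (M : nat) (lam : 'I_M -> R) (u : 'I_M -> 'cV[R]_M)
    (k p j : 'I_M) : R :=
  if 0 <= lam p * lam j then
    if 0 <= u p k 0 * u j k 0 then nu_plus u p j * (u p k 0 * u j k 0)
    else nu_minus u p j * (u p k 0 * u j k 0)
  else nu_max u p j * `|u p k 0 * u j k 0|.

Definition eps_c (R : realType) (M : nat) (lam : 'I_M -> R) (u : 'I_M -> 'cV[R]_M)
    (k : 'I_M) : R :=
  M%:R * \sum_(p < M) \sum_(j < M | (0 < j)%N)
    `|lam p * lam j| / (1 - `|lam p * lam j|) * a_coef lam u k p j.

(** Arms, ranks and incorrect selections *)

(* [b j] is the j.+1-th best arm. *)
Definition ranks_arms (R : realType) (N : nat) (m : 'I_N -> R) (b : 'S_N) : Prop :=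
  forall j l : 'I_N, (j < l)%N -> m (b l) < m (b j).

Definition best_arms (N : nat) (b : 'S_N) (j : nat) : {set 'I_N} :=
  [set b l | l : 'I_N & (l < j)%N].

(* The (one-based) label of the agent targeting arm i, and 0 if no agent does. *)
Definition target_agent (M N : nat) (b : 'S_N) (i : 'I_N) : nat :=
  if i \in best_arms b M then ((b^-1)%g i).+1 else 0%N.

Definition incorrect (M N : nat) (b : 'S_N) (k : 'I_M) (i : 'I_N) : bool :=
  (i \in best_arms b M) ==> (k.+1 != target_agent M b i).

Definition Delta_min (R : realType) (N : nat) (m : 'I_N -> R) : R :=
  inf [set x | exists i j : 'I_N, i != j /\ x = `|m i - m j|].

(* [sel k t] is the arm selected by agent k at time t, here along one sample
   path. *)
Definition nbar (M N : nat) (b : 'S_N) (sel : 'I_M -> nat -> 'I_N)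
    (i : 'I_N) (k : 'I_M) (T : nat) : nat :=
  (\sum_(1 <= t < T.+1 | incorrect b k i) (sel k t == i))%N.

(** Cooperative estimation and coop-UCB2-selective-learning, along one sample path *)

Fixpoint nhat (R : realType) (M N : nat) (Pm : 'M[R]_M) (sel : 'I_M -> nat -> 'I_N)
    (i : 'I_N) (t : nat) : 'cV[R]_M :=
  if t is s.+1 then
    Pm *m (nhat Pm sel i s + \col_k (sel k t == i)%:R)
  else 0.

(* Under the constrained reward model a reward is received only by an agent that
   is alone on its arm, but its value is observed in any case: the estimator uses
   [r i k t] whenever agent k selects i, whether or not a collision occurs. *)
Fixpoint shat (R : realType) (M N : nat) (Pm : 'M[R]_M) (sel : 'I_M -> nat -> 'I_N)
    (r : 'I_N -> 'I_M -> nat -> R) (i : 'I_N) (t : nat) : 'cV[R]_M :=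
  if t is s.+1 then
    Pm *m (shat Pm sel r i s + \col_k (r i k t * (sel k t == i)%:R))
  else 0.

Definition muhat (R : realType) (M N : nat) (Pm : 'M[R]_M) (sel : 'I_M -> nat -> 'I_N)
    (r : 'I_N -> 'I_M -> nat -> R) (i : 'I_N) (k : 'I_M) (t : nat) : R :=
  shat Pm sel r i t k 0 / nhat Pm sel i t k 0.

Definition G (R : realType) (eta : R) : R := 1 - eta ^+ 2 / 16%:R.

Definition conf_width (R : realType) (M N : nat) (sigma gamma eta : R) (f : R -> R)
    (Pm : 'M[R]_M) (sel : 'I_M -> nat -> 'I_N) (i : 'I_N) (k : 'I_M) (t : nat) : R :=
  let n := nhat Pm sel i t k 0 in
  sigma * Num.sqrt (2 * gamma / G eta * ((n + f t%:R) / (M%:R * n)) * (ln t%:R / n)).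

Definition Qstat (R : realType) (M N : nat) (sigma gamma eta : R) (f : R -> R)
    (Pm : 'M[R]_M) (sel : 'I_M -> nat -> 'I_N) (r : 'I_N -> 'I_M -> nat -> R)
    (i : 'I_N) (k : 'I_M) (t : nat) : R :=
  muhat Pm sel r i k t + conf_width sigma gamma eta f Pm sel i k t.

Definition Wstat (R : realType) (M N : nat) (sigma gamma eta : R) (f : R -> R)
    (Pm : 'M[R]_M) (sel : 'I_M -> nat -> 'I_N) (r : 'I_N -> 'I_M -> nat -> R)
    (i : 'I_N) (k : 'I_M) (t : nat) : R :=
  muhat Pm sel r i k t - conf_width sigma gamma eta f Pm sel i k t.

(* [O] consists of n arms carrying the n highest values of [Q]; it is not unique
   when there are ties. *)
Definition top_arms (R : realType) (N : nat) (Q : 'I_N -> R) (n : nat)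
    (O : {set 'I_N}) : Prop :=
  #|O| = n /\ forall i j, i \in O -> j \notin O -> Q j <= Q i.

Definition argmin_in (R : realType) (N : nat) (W : 'I_N -> R) (O : {set 'I_N})
    (i : 'I_N) : Prop :=
  i \in O /\ forall j, j \in O -> W i <= W j.

(* In the one-based numbering agent k.+1 selects arm (t - 1 + k.+1) mod N, with 0
   read as N; on zero-based labels this is (t - 1 + k) mod N.  Ties are broken
   arbitrarily. *)
Definition coop_UCB2_selective (R : realType) (M N : nat) (sigma gamma eta : R)
    (f : R -> R) (Pm : 'M[R]_M) (sel : 'I_M -> nat -> 'I_N)
    (r : 'I_N -> 'I_M -> nat -> R) : Prop :=
  forall (k : 'I_M) (t : nat), (0 < t)%N ->
    if (t <= N)%N then val (sel k t) = ((t.-1 + k) %% N)%N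
    else exists O : {set 'I_N},
      top_arms (fun i => Qstat sigma gamma eta f Pm sel r i k t.-1) k.+1 O /\
      argmin_in (fun i => Wstat sigma gamma eta f Pm sel r i k t.-1) O (sel k t).

(** Probabilistic model of the rewards *)

Definition mutually_independent (d : measure_display) (Om : measurableType d)
    (R : realType) (Pr : probability Om R) (I : choiceType) (D : set I)
    (X : I -> Om -> R) : Prop :=
  forall (s : seq I) (B : I -> set R), uniq s -> (forall j, j \in s -> D j) ->
    (forall j, measurable (B j)) ->
    Pr (\bigcap_(j in [set` s]) (X j @^-1` B j)) =
    (\prod_(j <- s) Pr (X j @^-1` B j))%E.

Definition independent_systems (d : measure_display) (Om : measurableType d)
    (R : realType) (Pr : probability Om R) (F1 F2 : set (set Om)) : Prop :=
  forall A B, F1 A -> F2 B -> Pr (A `&` B) = (Pr A * Pr B)%E.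

Definition sub_gaussian (d : measure_display) (Om : measurableType d)
    (R : realType) (Pr : probability Om R) (sigma mean : R)
    (X : {RV Pr >-> R}) : Prop :=
  Pr.-integrable [set: Om] (EFin \o X) /\ ('E_Pr[X] = mean%:E)%E /\
  forall beta : R,
    (lne ('M_Pr X beta) <= (mean * beta + sigma ^+ 2 * beta ^+ 2 / 2)%:E)%E.

Definition reward_sigma_algebra (d : measure_display) (Om : measurableType d)
    (R : realType) (M N : nat) (r : 'I_N -> 'I_M -> nat -> Om -> R) (t : nat) :
    set (set Om) :=
  <<s [set A | exists i k (B : set R), measurable B /\ A = r i k t @^-1` B] >>.

(* Information available when the rewards of time t are drawn: the values measured
   strictly before t, and the selections made up to and including t.  Up to ties,
   these selections are functions of the measurements; keeping those of time t
   here says that ties are not broken by looking at the rewards to come. *)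
Definition history (d : measure_display) (Om : measurableType d)
    (R : realType) (M N : nat) (sel : 'I_M -> nat -> Om -> 'I_N)
    (r : 'I_N -> 'I_M -> nat -> Om -> R) (t : nat) : set (set Om) :=
  <<s [set A | (exists k s i, (0 < s <= t)%N /\ A = sel k s @^-1` [set i]) \/
               (exists k s (B : set R), (0 < s < t)%N /\ measurable B /\
                  A = (fun w => r (sel k s w) k s w) @^-1` B)] >>.

Record reward_model (d : measure_display) (Om : measurableType d)
    (R : realType) (Pr : probability Om R) (M N : nat) (sigma : R) (m : 'I_N -> R)
    (r : 'I_N -> 'I_M -> nat -> {RV Pr >-> R})
    (sel : 'I_M -> nat -> Om -> 'I_N) : Prop := RewardModel {
  reward_sub_gaussian : forall i k t, (0 < t)%N -> sub_gaussian sigma (m i) (r i k t);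
  reward_ident : forall i k l s t (B : set R), (0 < s)%N -> (0 < t)%N ->
    measurable B -> distribution Pr (r i k s) B = distribution Pr (r i l t) B;
  (* For a given arm: over time for each agent, and across agents. *)
  reward_indep : forall i,
    mutually_independent Pr [set kt : 'I_M * nat | (0 < kt.2)%N]
      (fun kt => r i kt.1 kt.2);
  reward_indep_past : forall t, (0 < t)%N ->
    independent_systems Pr (reward_sigma_algebra r t) (history sel r t) }.

(** The bound *)

(* Time is the half-line [1, +oo): [f] is only evaluated there. *)
Definition increasing_sublogarithmic (R : realType) (f : R -> R) : Prop :=
  {in `[1, +oo[ &, {homo f : x y / x < y}} /\ f x / ln x @[x --> +oo] --> (0 : R).

Definition f_inv (R : realType) (f : R -> R) : R -> R :=
  'pinv_(fun=> 0) [set` `[1%R, +oo[] f.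

Definition Lbar (R : realType) (M N : nat) (gamma eta : R) (f : R -> R) (en : R)
    (ec : 'I_M -> R) : R :=
  \sum_(k < M) (f_inv f (ec k) - 1) + M%:R * (1 + en) + 1 +
  2 * M%:R * (N.+1)%:R / ln (1 + eta) *
    (1 / (gamma - 1) ^+ 2 + gamma * ln ((1 + en) * (1 + eta)) / (gamma - 1) + 1).

Definition leading_term (R : realType) (M T : nat) (sigma gamma eta Delta : R)
    (f : R -> R) : R :=
  4 * sigma ^+ 2 * gamma / (Delta ^+ 2 * G eta) *
  (1 + Num.sqrt (1 + Delta ^+ 2 * M%:R * G eta / (2 * sigma ^+ 2 * gamma) *
                     (f T%:R / ln T%:R))) * ln T%:R.

(* Main.v *)
Require Import Defs.
From mathcomp Require Import measurable_realfun ring lra zify.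

Set Implicit Arguments.
Unset Strict Implicit.
Unset Printing Implicit Defensive.

(** Fix an agent k, an arm h and a time s. Unrolling the two recursions gives
    nhat = sum of P^(s-j)_(k,l) xi_h^l(j) and shat - m_h nhat = the same sum of
    centred rewards, with deterministic nonnegative weights. The square weights
    are P^e_(k,l)^2 = P^e_(k,l) / M + (products of spectral components), and the
    index eps_c^k is exactly what bounds the second part after summation over
    e: the variance proxy V of the centred sum is at most (nhat + eps_c^k) / M
    ([wsqsum_le]). In the same way eps_n bounds by how much nhat falls short of
    the mean number of selections per agent ([wsum_ge_mean]).

    Selections up to time t are independent of the rewards of time t, and those
    are independent across agents, so for each fixed b the process
    exp(b S - sigma^2 b^2 V / 2) is a supermartingale started at 1
    ([integral_tilt_le1]). As V is random, b is chosen on a geometric grid: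
    Y = (nhat + f(s)) / M, which dominates V once f(s) >= eps_c^k, lies in one of
    about ln((s+1)(1+eps_n)) / ln(1+eta) cells of ratio 1 + eta, and in each cell
    a single b loses at most the factor G(eta) in the exponent ([peel_cell]).
    Hence the indicator of a deviation beyond the confidence width is at most
    s^-gamma times a sum of these exponentials, pointwise ([peeling]), and
    taking expectations bounds its probability. The grid starts at a deterministic
    positive lower bound of nhat + f(s): the round robin gives
    nhat >= 1 - eps_n, and also nhat >= 1 - sqrt(eps_c^k), since the
    agents sample a given arm at different times and Cauchy-Schwarz compares
    their weights with the trace-like sum inside eps_c^k
    ([wsum_ge_distinct], [count_range]).

    If agent k picks an arm i other than its target while the width of i is at
    most Delta_min / 2, then some arm has an estimation error beyond its width,
    in a direction determined by whether i is worse or better than the target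
    ([selection_error]). Widths are that small as soon as nhat exceeds the
    leading term divided by M ([width_le]). A selection of i by k at time s + 1
    is therefore covered by one of five charges ([path_bound]): the round robin
    (one selection per agent), the 2 M following steps during which nhat may
    still vanish ([wt_gt0]), the steps with s < f^-1(eps_c^k), the steps at
    which arm i has been selected too rarely, and the exponential bounds above.

    In expectation the last charge is at most
    M N / ln(1+eta) (2/(gamma-1)^2 + 1 + ln((1+eps_n)(1+eta))/(gamma-1)).
    For given i and k only N one-sided deviations matter, one per arm, against the
    factor 2 (N + 1) of the last summand of the constant. So that summand exceeds
    this charge by at least 2 M (N + 1) >= 2 M + 2 M^2, which pays for the round
    robin, for the 2 M steps of each agent, and for counting f^-1(eps_c^k) early
    steps instead of f^-1(eps_c^k) - 1. *)

(** * Weights of the consensus iteration *)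

Lemma sqr_sum_le (R : realDomainType) (I : finType) (a : I -> R) :
  (\sum_i a i) ^+ 2 <= #|I|%:R * \sum_i a i ^+ 2.
Proof.
have h : 0 <= \sum_i \sum_j (a i - a j) ^+ 2.
  by apply: sumr_ge0 => i _; apply: sumr_ge0 => j _; exact: sqr_ge0.
have : \sum_i \sum_j (a i - a j) ^+ 2
    = 2 * (#|I|%:R * \sum_i a i ^+ 2 - (\sum_i a i) ^+ 2).
  transitivity (\sum_i (#|I|%:R * a i ^+ 2 - 2 * (a i * \sum_j a j)
                        + \sum_j a j ^+ 2)).
    apply: eq_bigr => i _.
    have -> : #|I|%:R * a i ^+ 2 = \sum_(j : I) a i ^+ 2.
      by rewrite sumr_const mulr_natl.
    rewrite mulr_sumr mulr_sumr -sumrB -big_split/=.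
    by apply: eq_bigr => j _; ring.
  rewrite big_split/= sumrB sumr_const -mulr_sumr -mulr_sumr -mulr_suml.
  by rewrite -[_ *+ #|_|]mulr_natl; ring.
by move=> e; move: h; rewrite e pmulr_rge0// subr_ge0.
Qed.

Lemma geom_sum_le (R : realFieldType) (x : R) (t : nat) : 0 <= x < 1 ->
  \sum_(s < t) x ^+ (t - s) <= x / (1 - x).
Proof.
move=> /andP[x0 x1].
have d0 : 0 < 1 - x by rewrite subr_gt0.
rewrite ler_pdivlMr// (reindex_inj rev_ord_inj)/=.
have -> : \sum_(j < t) x ^+ (t - (t - j.+1)) = x * \sum_(j < t) x ^+ j.
  rewrite mulr_sumr; apply: eq_bigr => j _.
  by rewrite subKn ?ltn_ord// exprS.
have /= := subrX1 x t; rewrite -[_ - 1]opprB -[x - 1]opprB mulNr => /oppr_inj e.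
by rewrite -mulrA [_ * (1 - x)]mulrC -e ler_piMr// gerBl exprn_ge0.
Qed.

Section Weights.
Context (R : realType) (M : nat) (lam : 'I_M -> R) (u : 'I_M -> 'cV[R]_M).

(** The entry (k, d) of the e-th power of the consensus matrix, written in the
    eigenbasis: [wtD] is the power law and [wt0], [wtS] identify it. *)
Definition wt (e : nat) (k d : 'I_M) : R :=
  \sum_(p < M) lam p ^+ e * (u p k 0 * u p d 0).

(** What is left of [wt] without the constant eigenvector, see [wt_dev]. *)
Definition dev (e : nat) (k d : 'I_M) : R :=
  \sum_(p < M | (0 < p)%N) lam p ^+ e * (u p k 0 * u p d 0).

Lemma wt_sym e k d : wt e k d = wt e d k.
Proof. by apply: eq_bigr => p _; rewrite [u p k 0 * _]mulrC. Qed.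

Context (Pm : 'M[R]_M) (hspec : consensus_spectrum Pm lam u).

Let orth := spectrum_orthonormal hspec.

Lemma eigvec_complete k d : \sum_(p < M) u p k 0 * u p d 0 = (k == d)%:R.
Proof.
pose U : 'M[R]_M := \matrix_(p, d) u p d 0.
have UU : U *m U^T = 1%:M.
  apply/matrixP => p q; rewrite !mxE -orth.
  by apply: eq_bigr => j _; rewrite !mxE.
have /matrixP/(_ k d) := mulmx1C UU; rewrite !mxE => <-.
by apply: eq_bigr => j _; rewrite !mxE.
Qed.

Lemma wt0 k d : wt 0 k d = (k == d)%:R.
Proof.
by rewrite -eigvec_complete; apply: eq_bigr => p _; rewrite expr0 mul1r.
Qed.

Lemma wtS e k d : wt e.+1 k d = \sum_l Pm k l * wt e l d.
Proof.
rewrite /wt; under [RHS]eq_bigr do rewrite mulr_sumr.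
rewrite exchange_big/=; apply: eq_bigr => p _.
have /matrixP/(_ k 0) := spectrum_eigen hspec p; rewrite !mxE => h.
rewrite exprSr -mulrA [lam p * _]mulrA -h mulr_suml mulr_sumr.
by apply: eq_bigr => l _; ring.
Qed.

Lemma wtD a b k d : wt (a + b) k d = \sum_l wt a k l * wt b l d.
Proof.
elim: a k => [|a IH] k.
  under eq_bigr do rewrite wt0.
  rewrite (bigD1 k)//= eqxx mul1r big1 ?addr0// => l lk.
  by rewrite eq_sym (negbTE lk) mul0r.
rewrite addSn wtS; under eq_bigr do rewrite IH mulr_sumr.
rewrite exchange_big/=; apply: eq_bigr => l _.
by rewrite wtS mulr_suml; apply: eq_bigr => j _; rewrite mulrA.
Qed.

Lemma eigvec_norm p : \sum_d u p d 0 ^+ 2 = 1.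
Proof.
have := orth p p; rewrite eqxx mulr1n => <-.
by apply: eq_bigr => d _; rewrite expr2.
Qed.

Lemma eigvec_entry_le1 p k : `|u p k 0| <= 1.
Proof.
rewrite -(@ler_sqr _ `|_| 1) ?nnegrE// expr1n real_normK ?num_real//.
rewrite -(eigvec_norm p) (bigD1 k)//= lerDl.
by apply: sumr_ge0 => d _; exact: sqr_ge0.
Qed.

Lemma eigvec_norm1 p : \sum_d `|u p d 0| <= Num.sqrt M%:R.
Proof.
rewrite -[leLHS]ger0_norm ?sumr_ge0// -sqrtr_sqr.
apply: ler_wsqrtr; have := sqr_sum_le (fun d => `|u p d 0|).
rewrite card_ord; under [X in _ <= _ * X]eq_bigr do rewrite real_normK ?num_real//.
by rewrite eigvec_norm mulr1.
Qed.

Lemma eigval_norm_lt1 (p : 'I_M) : (0 < p)%N -> `|lam p| < 1.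
Proof. by move=> /(spectrum_other hspec); rewrite ltr_norml. Qed.

Lemma eigval_norm_le1 (p : 'I_M) : `|lam p| <= 1.
Proof.
have [p0|/eigval_norm_lt1/ltW//] := posnP p.
by have [-> _] := spectrum_first hspec p0; rewrite normr1.
Qed.

Hypothesis hM : (0 < M)%N.
Let p0 := Ordinal hM.

Lemma eigvec_first k : u p0 k 0 = (Num.sqrt M%:R)^-1.
Proof. by have [_ ->] := @spectrum_first _ _ _ _ _ hspec p0 erefl; rewrite mxE. Qed.

Lemma natM_neq0 : M%:R != 0 :> R.
Proof. by rewrite pnatr_eq0 -lt0n. Qed.

Lemma natM_gt0 : 0 < M%:R :> R.
Proof. by rewrite ltr0n. Qed.

Lemma split_first (F : 'I_M -> R) :
  \sum_p F p = F p0 + \sum_(p < M | (0 < p)%N) F p.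
Proof.
rewrite (bigD1 p0)//=; congr (_ + _); apply: eq_bigl => p.
by rewrite lt0n.
Qed.

Lemma wt_dev e k d : wt e k d = M%:R^-1 + dev e k d.
Proof.
rewrite /wt split_first; congr (_ + _).
have [-> _] := @spectrum_first _ _ _ _ _ hspec p0 erefl.
by rewrite !eigvec_first expr1n mul1r -expr2 exprVn sqr_sqrtr.
Qed.

Lemma row_sum k : \sum_l Pm k l = 1.
Proof.
have /matrixP/(_ k 0) := spectrum_eigen hspec p0.
have [-> ->] := @spectrum_first _ _ _ _ _ hspec p0 erefl.
rewrite scale1r !mxE; under eq_bigr do rewrite mxE.
rewrite -mulr_suml => h; apply: (@mulIf _ (Num.sqrt M%:R)^-1).
  by rewrite invr_neq0// sqrtr_eq0 -ltNge natM_gt0.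
by rewrite h mul1r.
Qed.

Hypothesis P0 : forall k l, 0 <= Pm k l.

Lemma wt_ge0 e k d : 0 <= wt e k d.
Proof.
elim: e k => [|e IH] k; first by rewrite wt0 ler0n.
by rewrite wtS; apply: sumr_ge0 => l _; rewrite mulr_ge0.
Qed.

Lemma wt_sum e k : \sum_d wt e k d = 1.
Proof.
elim: e k => [|e IH] k.
  rewrite (bigD1 k)//= wt0 eqxx big1 ?addr0// => d dk.
  by rewrite wt0 eq_sym (negbTE dk).
under eq_bigr do rewrite wtS.
rewrite exchange_big/=; under eq_bigr do rewrite -mulr_sumr IH mulr1.
exact: row_sum.
Qed.

Lemma wt2_diag_gt0 k : 0 < wt 2 k k.
Proof.
rewrite wt_dev ltr_pwDl ?invr_gt0 ?natM_gt0//.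
by apply: sumr_ge0 => p _; rewrite mulr_ge0 ?sqr_ge0// -expr2 sqr_ge0.
Qed.

(** If the entry (k, d) vanished for every exponent 2 e with e < M, so would its
    spectral expansion with any polynomial of degree below M in the squared
    eigenvalues in place of lambda_p^(2 e). The one vanishing at all squared
    eigenvalues but 1 isolates the constant component, which is 1 / M. This is
    where -1 < lambda_p < 1 replaces a combinatorial study of walks. *)
Lemma wt_even_gt0 k d : exists2 e, (e < M)%N & 0 < wt e.*2 k d.
Proof.
apply: contrapT => h.
have z e : (e < M)%N -> wt e.*2 k d = 0.
  move=> eM; apply/eqP; rewrite eq_le wt_ge0 andbT leNgt.
  by apply/negP => ?; apply: h; exists e.
(* A polynomial in x = lambda ^+ 2 that kills every spectral component but the
   constant one; its size is M, so e < M suffices. *)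
pose A : pred 'I_M := fun p => (0 < p)%N.
pose g : {poly R} := \prod_(j <- [seq lam p ^+ 2 | p in A]) ('X - j%:P).
have sg : (size g <= M)%N.
  rewrite size_prod_XsubC size_image -[X in (_ < X)%N](card_ord M).
  apply: proper_card; apply/properP; split; first exact: subset_predT.
  by exists p0; rewrite ?inE.
have : \sum_(p < M) g.[lam p ^+ 2] * (u p k 0 * u p d 0) = 0.
  transitivity (\sum_(e < size g) g`_e * wt e.*2 k d).
    under eq_bigr do rewrite horner_coef mulr_suml.
    rewrite exchange_big/=; apply: eq_bigr => e _.
    rewrite mulr_sumr; apply: eq_bigr => p _.
    by rewrite -exprM mul2n -mulrA.
  by rewrite big1// => e _; rewrite z ?mulr0// (leq_trans (ltn_ord e) sg).
rewrite split_first big1 ?addr0 => [|p pp].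
  have [-> _] := @spectrum_first _ _ _ _ _ hspec p0 erefl.
  rewrite !eigvec_first -expr2 exprVn sqr_sqrtr// expr1n => /eqP.
  rewrite mulf_eq0 invr_eq0 (negbTE natM_neq0) orbF -[_ == 0]/(root g _).
  rewrite /g root_prod_XsubC => /mapP[q]; rewrite mem_enum => q0 /esym/eqP.
  rewrite sqrf_eq1 => /orP[]/eqP e; have := spectrum_other hspec q0.
    by rewrite e ltxx andbF.
  by rewrite e ltxx.
suff /rootP -> : root g (lam p ^+ 2) by rewrite mul0r.
by rewrite /g root_prod_XsubC; apply/mapP; exists p; rewrite ?mem_enum.
Qed.

(** The diagonal of P^2 is at least 1 / M, so positivity of an even power
    persists along even exponents; multiplying by a stochastic matrix then covers
    the odd ones. *)
Lemma wt_gt0 e k d : (M.*2 <= e)%N -> 0 < wt e k d.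
Proof.
have base a : 0 < wt M.*2 a d.
  have [e0 e0M h] := wt_even_gt0 a d.
  have H n : 0 < wt (n + e0).*2 a d.
    elim: n => // n IH; rewrite addSn doubleS -add2n wtD (bigD1 a)//=.
    rewrite ltr_pwDl ?mulr_gt0 ?wt2_diag_gt0//.
    by apply: sumr_ge0 => l _; rewrite mulr_ge0 ?wt_ge0.
  by have := H (M - e0)%N; rewrite subnK// ltnW.
move=> /subnK <-; rewrite wtD.
have : \sum_l wt (e - M.*2) k l * wt M.*2 l d != 0.
  apply/negP; rewrite psumr_eq0 => [|l _]; last by rewrite mulr_ge0 ?wt_ge0.
  move=> /allP H; have := wt_sum (e - M.*2) k.
  rewrite big1 => [/esym/eqP|l _]; first by rewrite oner_eq0.
  have /implyP/(_ isT) := H l (mem_index_enum _).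
  by rewrite mulf_eq0 (gt_eqF (base l)) orbF => /eqP.
by rewrite lt_def => ->; apply: sumr_ge0 => l _; rewrite mulr_ge0 ?wt_ge0.
Qed.

End Weights.

(** * Cooperative estimators and explore-exploit indices *)

Section Estimators.
Context (R : realType) (M : nat) (lam : 'I_M -> R) (u : 'I_M -> 'cV[R]_M).
Context (Pm : 'M[R]_M) (hspec : consensus_spectrum Pm lam u).

Let w := wt lam u.

(** Both estimators of an arm are of this form, [x] being the selection
    indicators or the rewards they select ([nhat_wsum], [shat_wsum]). The index
    s stands for time s + 1. *)
Definition wsum (x : nat -> 'I_M -> R) (k : 'I_M) (t : nat) : R :=
  \sum_(s < t) \sum_d w (t - s) k d * x s d.

Definition wsqsum (x : nat -> 'I_M -> R) (k : 'I_M) (t : nat) : R :=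
  \sum_(s < t) \sum_d w (t - s) k d ^+ 2 * x s d.

Lemma wsumS x k t : wsum x k t.+1 = \sum_l Pm k l * (wsum x l t + x t l).
Proof.
rewrite /wsum big_ord_recr/= subSnn.
under [RHS]eq_bigr do rewrite mulrDr.
rewrite big_split/=; congr (_ + _); last first.
  apply: eq_bigr => d _; congr (_ * _); rewrite /w (wtS hspec) (bigD1 d)//=.
  rewrite (wt0 hspec) eqxx mulr1 big1 ?addr0// => l ld.
  by rewrite (wt0 hspec) (negbTE ld) mulr0.
under [RHS]eq_bigr do rewrite mulr_sumr.
rewrite [RHS]exchange_big/=; apply: eq_bigr => s _.
under [RHS]eq_bigr do rewrite mulr_sumr.
rewrite [RHS]exchange_big/=; apply: eq_bigr => d _.
rewrite subSn 1?ltnW// /w (wtS hspec) mulr_suml.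
by apply: eq_bigr => l _; rewrite mulrA.
Qed.

Lemma nhat_wsum N (sel : 'I_M -> nat -> 'I_N) i t k :
  nhat Pm sel i t k 0 = wsum (fun s d => (sel d s.+1 == i)%:R) k t.
Proof.
elim: t k => [|t IH] k /=; first by rewrite /wsum big_ord0 mxE.
by rewrite mxE wsumS; apply: eq_bigr => l _; rewrite !mxE IH.
Qed.

Lemma shat_wsum N (sel : 'I_M -> nat -> 'I_N) r i t k :
  shat Pm sel r i t k 0
  = wsum (fun s d => r i d s.+1 * (sel d s.+1 == i)%:R) k t.
Proof.
elim: t k => [|t IH] k /=; first by rewrite /wsum big_ord0 mxE.
by rewrite mxE wsumS; apply: eq_bigr => l _; rewrite !mxE IH.
Qed.

Hypothesis hM : (0 < M)%N.
Hypothesis P0 : forall k l, 0 <= Pm k l.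

Let w0 e k d : 0 <= w e k d.
Proof. exact: (wt_ge0 hspec). Qed.

Lemma wsum_le (x : nat -> 'I_M -> R) k t :
  (forall s d, 0 <= x s d <= 1) -> wsum x k t <= t%:R.
Proof.
move=> x01; rewrite -[t in leRHS]card_ord -sumr_const.
apply: ler_sum => s _; rewrite -(wt_sum hspec hM (t - s) k).
apply: ler_sum => d _; have /andP[_ x1] := x01 s d.
by rewrite ler_piMr// w0.
Qed.

(** The component of eigenvalue lambda_p contributes at most
    |lambda_p|^e |u_p^k| times the 1-norm of u_p, that is sqrt M |lambda_p|^e;
    summing the geometric series gives [eps_n]. *)
Lemma wsum_ge_mean (x : nat -> 'I_M -> R) k t : (forall s d, 0 <= x s d <= 1) ->
  M%:R^-1 * (\sum_(s < t) \sum_d x s d) - eps_n lam <= wsum x k t.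
Proof.
move=> x01; have x0 s d : 0 <= x s d by have /andP[] := x01 s d.
have -> : wsum x k t = M%:R^-1 * (\sum_(s < t) \sum_d x s d)
    + \sum_(p < M | (0 < p)%N) \sum_(s < t)
        lam p ^+ (t - s) * (u p k 0 * \sum_d u p d 0 * x s d).
  rewrite [X in _ = _ + X]exchange_big/= mulr_sumr -big_split/=.
  apply: eq_bigr => s _.
  rewrite mulr_sumr.
  transitivity (\sum_d (M%:R^-1 * x s d + dev lam u (t - s) k d * x s d)).
    by apply: eq_bigr => d _; rewrite -mulrDl -(wt_dev hspec hM).
  rewrite big_split/=; congr (_ + _).
  under eq_bigr do rewrite mulr_suml.
  rewrite exchange_big/=; apply: eq_bigr => p _.
  by rewrite !mulr_sumr; apply: eq_bigr => d _; ring.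
rewrite lerD2l lerNl -sumrN /eps_n mulr_sumr; apply: ler_sum => p pp.
rewrite -sumrN.
apply: (@le_trans _ _ (\sum_(s < t) `|lam p| ^+ (t - s) * Num.sqrt M%:R)).
  apply: ler_sum => s _; apply: le_trans (ler_norm _) _.
  rewrite normrN normrM normrX ler_wpM2l ?exprn_ge0// normrM.
  apply: (@le_trans _ _ (1 * `|\sum_d u p d 0 * x s d|)).
    by rewrite ler_wpM2r// (eigvec_entry_le1 hspec).
  rewrite mul1r (le_trans (ler_norm_sum _ _ _))//.
  apply: le_trans (eigvec_norm1 hspec p); apply: ler_sum => d _.
  by rewrite normrM ler_piMr// ger0_norm//; have /andP[] := x01 s d.
rewrite -mulr_suml mulrC ler_wpM2l// geom_sum_le// normr_ge0/=.
exact: (eigval_norm_lt1 hspec).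
Qed.

Lemma a_coef_ge0 k p j : 0 <= a_coef lam u k p j.
Proof.
rewrite /a_coef; have np : 0 <= nu_plus u p j by exact: sumr_ge0.
case: ifP => _; last by rewrite mulr_ge0// /nu_max le_max normr_ge0.
case: ifP => [h|/negbT]; first exact: mulr_ge0.
by rewrite -ltNge => /ltW h; rewrite mulr_le0//; exact: sumr_le0.
Qed.

Lemma cross_bounds (x : 'I_M -> R) p j : (forall d, 0 <= x d <= 1) ->
  nu_minus u p j <= \sum_d u p d 0 * u j d 0 * x d <= nu_plus u p j.
Proof.
move=> x01; rewrite /nu_minus /nu_plus; apply/andP; split.
  rewrite [leLHS]big_mkcond/=; apply: ler_sum => d _.
  have /andP[a b] := x01 d; case: ifP => [h|/negbT]; first by nra.
  by rewrite -ltNge => h; nra.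
rewrite [leRHS]big_mkcond/=; apply: ler_sum => d _.
have /andP[a b] := x01 d; case: ifP => [h|/negbT]; first by nra.
by rewrite -ltNge => h; nra.
Qed.

(** [a_coef] is the worst case of the product over subsets of selecting
    agents: its three cases are the three possible signs. *)
Lemma cross_term_le (x : 'I_M -> R) k p j e : (forall d, 0 <= x d <= 1) ->
  (lam p * lam j) ^+ e * ((u p k 0 * u j k 0) * \sum_d u p d 0 * u j d 0 * x d)
  <= `|lam p * lam j| ^+ e * a_coef lam u k p j.
Proof.
move=> /(cross_bounds p j) /andP[]; set D := \sum_d _; set c := u p k 0 * _.
rewrite /a_coef -/c; set l := lam p * lam j => D1 D2.
case: ifP => [l0|_].
  rewrite ger0_norm// ler_wpM2l ?exprn_ge0//.
  case: ifP => [c0|/negbT]; first by rewrite [leRHS]mulrC ler_wpM2l.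
  by rewrite -ltNge => c0; rewrite [leRHS]mulrC ler_wnM2l// ltW.
apply: le_trans (ler_norm _) _.
rewrite [leLHS]normrM normrX (normrM c D) ler_wpM2l ?exprn_ge0//.
rewrite mulrC ler_wpM2r// /nu_max le_max.
have [D0|D0] := lerP 0 D; first by rewrite ger0_norm// D2 orbT.
by rewrite !ltr0_norm// ?lerN2 ?D1// (le_lt_trans D1).
Qed.

Lemma eigval_prod_norm_lt1 (p j : 'I_M) : (0 < j)%N -> `|lam p * lam j| < 1.
Proof.
move=> j0; rewrite normrM; apply: le_lt_trans (eigval_norm_lt1 hspec j0).
by rewrite ler_piMl// (eigval_norm_le1 hspec).
Qed.

Lemma index_term_ge0 k (p j : 'I_M) : (0 < j)%N ->
  0 <= `|lam p * lam j| / (1 - `|lam p * lam j|) * a_coef lam u k p j.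
Proof.
move=> j0; rewrite mulr_ge0 ?a_coef_ge0// divr_ge0// subr_ge0.
exact: ltW (eigval_prod_norm_lt1 p j0).
Qed.

Lemma eps_c_ge0 k : 0 <= eps_c lam u k.
Proof.
rewrite /eps_c mulr_ge0//; apply: sumr_ge0 => p _; apply: sumr_ge0 => j j0.
exact: index_term_ge0.
Qed.

Lemma eps_n_ge0 : 0 <= eps_n lam.
Proof.
rewrite /eps_n mulr_ge0 ?sqrtr_ge0//; apply: sumr_ge0 => p pp.
by rewrite divr_ge0// subr_ge0 ltW// (eigval_norm_lt1 hspec).
Qed.

(** In the square of the spectral expansion, the terms with j the constant
    eigenvector add up to [wt] / M, hence to nhat / M; each of the others is
    bounded by [cross_term_le] and a geometric series. *)
Lemma wsqsum_le (x : nat -> 'I_M -> R) k t : (forall s d, 0 <= x s d <= 1) ->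
  wsqsum x k t <= (wsum x k t + eps_c lam u k) / M%:R.
Proof.
move=> x01.
have -> : wsqsum x k t = wsum x k t / M%:R
    + \sum_p \sum_(j < M | (0 < j)%N) \sum_(s < t)
        (lam p * lam j) ^+ (t - s)
        * ((u p k 0 * u j k 0) * \sum_d u p d 0 * u j d 0 * x s d).
  under [X in _ = _ + X]eq_bigr do rewrite exchange_big/=.
  rewrite [X in _ = _ + X]exchange_big/= mulr_suml -big_split/=.
  apply: eq_bigr => s _.
  transitivity (\sum_d (w (t - s) k d * x s d / M%:R
                  + w (t - s) k d * dev lam u (t - s) k d * x s d)).
    by apply: eq_bigr => d _; rewrite expr2 {2}/w (wt_dev hspec hM); ring.
  rewrite big_split/= -mulr_suml; congr (_ + _).
  under eq_bigr do rewrite {1}/w /wt mulr_suml mulr_suml.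
  rewrite exchange_big/=; apply: eq_bigr => p _.
  under eq_bigr do rewrite mulr_sumr mulr_suml.
  rewrite exchange_big/=; apply: eq_bigr => j _.
  by rewrite !mulr_sumr; apply: eq_bigr => d _; rewrite exprMn; ring.
rewrite mulrDl lerD2l /eps_c mulrC mulKf ?natM_neq0//.
apply: ler_sum => p _; apply: ler_sum => j j0.
apply: (@le_trans _ _
    (\sum_(s < t) `|lam p * lam j| ^+ (t - s) * a_coef lam u k p j)).
  by apply: ler_sum => s _; exact: cross_term_le.
rewrite -mulr_suml ler_wpM2r ?a_coef_ge0// geom_sum_le// normr_ge0/=.
exact: eigval_prod_norm_lt1.
Qed.

(** The squares of row k of [dev] at e sum to its diagonal entry at 2 e. *)
Lemma dev_sqr_le e k d : dev lam u e k d ^+ 2 <= dev lam u e.*2 k k.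
Proof.
have -> : dev lam u e.*2 k k = \sum_l dev lam u e k l ^+ 2.
  have /eqP := wtD hspec e e k k.
  rewrite addnn; under eq_bigr do rewrite [wt _ _ _ _ k]wt_sym.
  rewrite (wt_dev hspec hM).
  under eq_bigr do rewrite -expr2 (wt_dev hspec hM) sqrrD.
  rewrite !big_split/= sumr_const card_ord -[_ ^+ 2 *+ M]mulr_natl.
  rewrite [M%:R^-1 ^+ 2]expr2 mulVKf ?natM_neq0// -addrA (inj_eq (addrI _)) => /eqP ->.
  suff -> : \sum_i M%:R^-1 * dev lam u e k i = 0 by rewrite !add0r.
  have := wt_sum hspec hM e k; under eq_bigr do rewrite (wt_dev hspec hM).
  rewrite big_split/= sumr_const card_ord -[_^-1 *+ M]mulr_natl mulfV ?natM_neq0//.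
  move=> /(canRL (addKr _)); rewrite addNr => z.
  by rewrite -mulr_sumr z mulr0.
by rewrite (bigD1 d)//= lerDl; apply: sumr_ge0 => l _; exact: sqr_ge0.
Qed.

Lemma dev_even_ge0 e k : 0 <= dev lam u e.*2 k k.
Proof.
apply: sumr_ge0 => p _; rewrite -mul2n exprM -expr2.
by apply: mulr_ge0; [apply: exprn_ge0|]; exact: sqr_ge0.
Qed.

(** The diagonal terms p = j of [eps_c] alone give this sum, because there
    nu_jj^{+sum} is the squared norm of u_j. *)
Lemma sum_dev_even_le k t :
  M%:R * (\sum_(s < t) dev lam u (t - s).*2 k k) <= eps_c lam u k.
Proof.
rewrite /eps_c ler_wpM2l// /dev exchange_big/=.
rewrite [leRHS]exchange_big/=; apply: ler_sum => j j0.
rewrite (bigD1 j)//= ler_wpDr//.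
  by apply: sumr_ge0 => p _; exact: index_term_ge0.
rewrite -mulr_suml.
have -> : a_coef lam u k j j = u j k 0 * u j k 0.
  rewrite /a_coef -!expr2 !sqr_ge0 /nu_plus.
  rewrite (_ : \sum_(d < M | _) _ = 1) ?mul1r//.
  rewrite -(eigvec_norm hspec j); apply: eq_big => d.
    by rewrite -expr2 sqr_ge0.
  by rewrite expr2.
rewrite ler_wpM2r -?expr2 ?sqr_ge0// ger0_norm ?sqr_ge0//.
under eq_bigr do rewrite -mul2n exprM.
apply: geom_sum_le; rewrite sqr_ge0/= -[ltLHS]ger0_norm ?sqr_ge0// expr2.
exact: eigval_prod_norm_lt1.
Qed.

(** If every agent has one sample, all at different times, then the deviations of
    the corresponding weights from 1 / M are at different exponents, so the sum of
    their squares is part of [eps_c] / M; Cauchy-Schwarz over the M agents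
    concludes. *)
Lemma wsum_ge_distinct (x : nat -> 'I_M -> R) k t (tau : 'I_M -> 'I_t) :
  injective tau -> (forall s d, 0 <= x s d) -> (forall d, x (tau d) d = 1) ->
  1 - Num.sqrt (eps_c lam u k) <= wsum x k t.
Proof.
move=> tinj x0 x1.
have h : \sum_d w (t - tau d) k d <= wsum x k t.
  rewrite /wsum [leRHS]exchange_big/=; apply: ler_sum => d _.
  rewrite (bigD1 (tau d))//= x1 mulr1 lerDl.
  by apply: sumr_ge0 => s _; rewrite mulr_ge0 ?w0.
apply: le_trans h.
have -> : \sum_d w (t - tau d) k d = 1 + \sum_d dev lam u (t - tau d) k d.
  have -> : 1 = \sum_(d < M) M%:R^-1 :> R.
    by rewrite sumr_const card_ord -[RHS]mulr_natl mulfV ?natM_neq0.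
  rewrite -big_split/=.
  by apply: eq_bigr => d _; rewrite -(wt_dev hspec hM).
rewrite lerD2l lerNl; apply: le_trans (ler_norm _) _.
rewrite normrN -sqrtr_sqr; apply: ler_wsqrtr.
apply: le_trans (sqr_sum_le _) _; rewrite card_ord.
apply: le_trans (sum_dev_even_le k t); rewrite ler_wpM2l//.
apply: (@le_trans _ _ (\sum_d dev lam u (t - tau d).*2 k k)).
  by apply: ler_sum => d _; exact: dev_sqr_le.
rewrite -(big_imset (fun s : 'I_t => dev lam u (t - s).*2 k k))/=; last first.
  by move=> a b _ _; exact: tinj.
rewrite [leRHS](bigID (mem [set tau d | d : 'I_M]%SET))/= lerDl.
by apply: sumr_ge0 => s _; exact: dev_even_ge0.
Qed.

End Estimators.

(** * Integrating products under factorization on events *)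

Section IntegralFactor.
Context d (T : measurableType d) (R : realType) (mu : {measure set T -> \bar R}).
Import HBNNSimple.

Let integral_mul_comp_sfun (H X : T -> R) (c : R) (h : {nnsfun R >-> R}) :
  measurable_fun setT H -> (forall x, 0 <= H x) -> measurable_fun setT X ->
  0 <= c ->
  (forall B, measurable B ->
     (\int[mu]_x (H x * \1_B (X x))%:E = c%:E * mu (X @^-1` B))%E) ->
  (\int[mu]_x (H x * h (X x))%:E = c%:E * \int[mu]_x (h (X x))%:E)%E.
Proof.
move=> mH H0 mX c0 Hc.
have mh1 y : measurable (h @^-1` [set y]) by [].
have m1 (K : T -> R) y : measurable_fun setT K ->
    measurable_fun setT (fun x => K x * \1_(h @^-1` [set y]) (X x)).
  move=> mK; apply: measurable_funM => //.
  exact: measurableT_comp (measurable_indic (mh1 y)) mX.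
have nn (K : T -> R) y x : (forall x, 0 <= K x) ->
    0 <= y * (K x * \1_(h @^-1` [set y]) (X x)).
  move=> K0; have [y0|y0] := ltP y 0.
    by rewrite preimage_nnfun0// indic0 !mulr0.
  by rewrite mulr_ge0// mulr_ge0.
have decomp (K : T -> R) : measurable_fun setT K -> (forall x, 0 <= K x) ->
    (\int[mu]_x (K x * h (X x))%:E = \sum_(y \in range h)
       (y%:E * \int[mu]_x (K x * \1_(h @^-1` [set y]) (X x))%:E))%E.
  move=> mK K0.
  transitivity (\int[mu]_x (\sum_(y \in range h)
      (y * (K x * \1_(h @^-1` [set y]) (X x)))%:E)%E)%E.
    apply: eq_integral => x _; rewrite fsumEFin//; congr EFin.
    rewrite {1}fimfunE mulr_fsumr; apply: eq_fsbigr => y _; ring.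
  rewrite ge0_integral_fsum//.
  - apply: eq_fsbigr => y; rewrite inE => -[z _ <-].
    under eq_integral do rewrite EFinM.
    rewrite ge0_integralZl_EFin//.
    + by move=> x _; rewrite lee_fin mulr_ge0.
    + by apply/measurable_EFinP; exact: m1.
  - move=> y; apply/measurable_EFinP; apply: measurable_funM => //.
    exact: m1.
  - by move=> y x _; rewrite lee_fin nn.
rewrite decomp//.
have := decomp (cst 1) (@measurable_cst _ _ _ _ _ _) (fun=> ler01).
under eq_integral do rewrite mul1r; move=> ->.
have E y : (\int[mu]_x (cst 1 x * \1_(h @^-1` [set y]) (X x))%:E
            = mu (X @^-1` (h @^-1` [set y])))%E.
  under eq_integral do rewrite mul1r.
  rewrite -[X in (\int[mu]_x X x)%E]/(EFin \o \1_(X @^-1` (h @^-1` [set y]))).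
  rewrite integral_indic ?setIT//.
  by rewrite -[X in measurable X]setTI; exact: mX.
rewrite ge0_mule_fsumr; last first.
  move=> y; rewrite E; have [y0|y0] := ltP y 0.
    by rewrite preimage_nnfun0// preimage_set0 measure0 mule0.
  by rewrite mule_ge0.
by apply: eq_fsbigr => y _; rewrite E Hc// muleCA.
Qed.

(** Factorization against indicators of X extends to nonnegative functions of X,
    through simple functions and monotone convergence. With H an indicator or a
    product of functions of other variables, this is the passage from
    independence of events to product of expectations, one variable at a time. *)
Lemma integral_mul_comp (H X : T -> R) (c : R) (g : R -> R) :
  measurable_fun setT H -> (forall x, 0 <= H x) -> measurable_fun setT X ->
  0 <= c ->
  (forall B, measurable B ->
     (\int[mu]_x (H x * \1_B (X x))%:E = c%:E * mu (X @^-1` B))%E) ->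
  measurable_fun setT g -> (forall y, 0 <= g y) ->
  (\int[mu]_x (H x * g (X x))%:E = c%:E * \int[mu]_x (g (X x))%:E)%E.
Proof.
move=> mH H0 mX c0 Hc mg g0.
have mg' : measurable_fun setT (EFin \o g) by exact/measurable_EFinP.
pose h := nnsfun_approx measurableT mg'.
have hg y : (h n y)%:E @[n --> \oo] --> (g y)%:E.
  by apply: cvg_nnsfun_approx => // z _; rewrite lee_fin.
have mhX n : measurable_fun setT (fun x => h n (X x)).
  exact: measurableT_comp (measurable_funPT (h n)) mX.
have lim (K : T -> R) : measurable_fun setT K -> (forall x, 0 <= K x) ->
    (\int[mu]_x (K x * g (X x))%:E
     = limn (fun n => \int[mu]_x (K x * h n (X x))%:E))%E.
  move=> mK K0; rewrite -monotone_convergence//.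
  - apply: eq_integral => x _; apply/esym/cvg_lim => //.
    under eq_fun do rewrite EFinM.
    by rewrite EFinM; apply: cvgeZl.
  - by move=> n; apply/measurable_EFinP; exact: measurable_funM.
  - by move=> n x _; rewrite lee_fin mulr_ge0.
  - move=> x _ a b ab; rewrite lee_fin ler_wpM2l//.
    exact/lefP/nd_nnsfun_approx.
rewrite lim//.
have := lim (cst 1) (@measurable_cst _ _ _ _ _ _) (fun=> ler01).
under eq_integral do rewrite mul1r; move=> ->.
rewrite -limeMl//.
  congr (limn _); apply/funext => n; rewrite (integral_mul_comp_sfun _ mH H0 mX c0 Hc).
  by congr (_ * _)%E; apply: eq_integral => x _; rewrite mul1r.
apply/ereal_nondecreasing_is_cvgn => a b ab; apply: ge0_le_integral => //.
- by move=> x _; rewrite lee_fin mulr_ge0.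
- by apply/measurable_EFinP; exact: measurable_funM.
- by apply/measurable_EFinP; exact: measurable_funM.
- by move=> x _; rewrite !mul1r lee_fin; exact/lefP/nd_nnsfun_approx.
Qed.

End IntegralFactor.

(** * The exponential supermartingale of a weighted reward sum *)

Lemma integral_expR_le (d : measure_display) (Om : measurableType d)
    (R : realType) (Pr : probability Om R) (sigma mean : R) (X : {RV Pr >-> R})
    (b : R) : sub_gaussian sigma mean X ->
  (\int[Pr]_w (expR (b * (X w - mean) - sigma ^+ 2 * b ^+ 2 / 2))%:E <= 1)%E.
Proof.
move=> [_ [_ /(_ b)]]; rewrite /mmt_gen_fun unlock => h.
set I := (\int[Pr]_w _)%E in h.
have mX : measurable_fun setT (fun w => expR (X w * b)).
  apply: measurableT_comp => //; exact: measurable_funM.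
have I0 : (0 <= I)%E by apply: integral_ge0 => w _; rewrite lee_fin expR_ge0.
have hI : (I <= (expR (mean * b + sigma ^+ 2 * b ^+ 2 / 2))%:E)%E.
  rewrite -[leRHS]/(expeR (_%:E)) -(@lneK _ I) ?lee_expeR//.
  by rewrite in_itv/= I0 leey.
have -> : (\int[Pr]_w (expR (b * (X w - mean) - sigma ^+ 2 * b ^+ 2 / 2))%:E
    = (expR (- (mean * b + sigma ^+ 2 * b ^+ 2 / 2)))%:E * I)%E.
  rewrite -ge0_integralZl_EFin ?expR_ge0//.
  - by apply: eq_integral => w _; rewrite -EFinM -expRD; congr (expR _)%:E => /=; ring.
  - by move=> w _; rewrite lee_fin expR_ge0.
  - exact/measurable_EFinP.
apply: le_trans (lee_wpmul2l _ hI) _; first by rewrite lee_fin expR_ge0.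
by rewrite -EFinM -expRD addNr expR0.
Qed.

Section Tilt.
Context (R : realType) (M : nat) (sigma mu : R).

(** exp(b S - sigma^2 b^2 V / 2) for the weighted sum S of centred rewards and its
    variance proxy V; xi indicates which rewards are sampled and the parameter b
    may depend on time and agent, which absorbs the weights. *)
Definition tilt (T : Type) (xi rho : nat -> 'I_M -> T -> R)
    (b : nat -> 'I_M -> R) (t : nat) (w : T) : R :=
  expR (\sum_(s < t) \sum_d
    xi s d w * (b s d * (rho s d w - mu) - sigma ^+ 2 * b s d ^+ 2 / 2)).

Lemma measurable_tilt d (T : measurableType d) (xi rho : nat -> 'I_M -> T -> R) b t :
  (forall s k, (s < t)%N -> measurable_fun setT (xi s k)) ->
  (forall s k, (s < t)%N -> measurable_fun setT (rho s k)) ->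
  measurable_fun setT (tilt xi rho b t).
Proof.
move=> mxi mrho; apply: measurableT_comp => //.
apply: measurable_sum => s; apply: measurable_sum => k.
apply: measurable_funM; first exact: mxi.
apply: measurable_funB => //; apply: measurable_funM => //.
by apply: measurable_funB => //; exact: mrho.
Qed.

End Tilt.

Section RewardModel.
Context (d : measure_display) (Om : measurableType d) (R : realType)
  (Pr : probability Om R) (M N : nat) (sigma : R) (m : 'I_N -> R)
  (r : 'I_N -> 'I_M -> nat -> {RV Pr >-> R}) (sel : 'I_M -> nat -> Om -> 'I_N).
Hypothesis hsel : forall k t i, (0 < t)%N -> measurable (sel k t @^-1` [set i]).
Hypothesis hr : reward_model sigma m r sel.

Section Factor.
Context (i : 'I_N) (t : nat) (t0 : (0 < t)%N).
Context (W : Om -> R) (cW : R).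
Hypothesis mW : measurable_fun setT W.
Hypothesis W0 : forall w, 0 <= W w.
Hypothesis hW : forall B, measurable B -> history sel r t (W @^-1` B).
Hypothesis EW : (\int[Pr]_w (W w)%:E = cW%:E)%E.

Let X k : Om -> R := r i k t.

Let mX k : measurable_fun setT (X k).
Proof. exact: measurable_funPT. Qed.

Let ind (B : 'I_M -> set R) (s : seq 'I_M) (w : Om) : R :=
  \prod_(k <- s) \1_(B k) (X k w).

Let evt (B : 'I_M -> set R) (s : seq 'I_M) : set Om :=
  \big[setI/setT]_(k <- s) (X k @^-1` B k).

Let indE B s w : ind B s w = \1_(evt B s) w.
Proof.
rewrite /ind /evt; elim: s => [|k s IH]; first by rewrite !big_nil indicT.
by rewrite !big_cons IH indicI.
Qed.

Let measurable_preX k (B : set R) : measurable B -> measurable (X k @^-1` B).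
Proof. by move=> mB; rewrite -[X in measurable X]setTI; exact: mX. Qed.

Let mevt B s : (forall k, measurable (B k)) -> measurable (evt B s).
Proof. by move=> mB; apply: bigsetI_measurable => k _; exact: measurable_preX. Qed.

Let evt_reward B s : (forall k, measurable (B k)) ->
  reward_sigma_algebra (fun i k t => r i k t : Om -> R) t (evt B s).
Proof.
move=> mB; rewrite /reward_sigma_algebra; set G := [set A | _].
change (G.-sigma.-measurable (evt B s)).
apply: bigsetI_measurable => k _; apply: sub_sigma_algebra.
by exists i, k, (B k).
Qed.

Let Pr_evt B s : uniq s -> (forall k, measurable (B k)) ->
  Pr (evt B s) = (\prod_(k <- s) Pr (X k @^-1` B k))%E.
Proof.
move=> us mB.
have := reward_indep hr i (s := [seq (k, t) | k <- s]) (B := fun kt => B kt.1).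
rewrite big_map/= => <-.
- congr (Pr _); rewrite bigcap_seq /evt big_map//.
- by rewrite map_inj_uniq// => a b [].
- by move=> kt /mapP[k _ ->].
- by move=> kt; exact: mB.
Qed.

Let mind B s : (forall k, measurable (B k)) -> measurable_fun setT (ind B s).
Proof.
move=> mB; rewrite (_ : ind B s = \1_(evt B s)).
  by apply: measurable_indic; exact: mevt.
by apply/funext => w; rewrite indE.
Qed.

Let integral_ind B s : uniq s -> (forall k, measurable (B k)) ->
  (\int[Pr]_w (ind B s w * W w)%:E
   = (\prod_(k <- s) fine (Pr (X k @^-1` B k)) * cW)%:E)%E.
Proof.
move=> us mB.
have PrE : Pr (evt B s) = (\prod_(k <- s) fine (Pr (X k @^-1` B k)))%:E.
  rewrite Pr_evt// -prodEFin; apply: eq_bigr => k _.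
  by rewrite fineK// fin_num_measure//; exact: measurable_preX.
have -> : (\int[Pr]_w (ind B s w * W w)%:E = \int[Pr]_w (ind B s w * `|W w|)%:E)%E.
  by apply: eq_integral => w _; rewrite ger0_norm.
pose c := \prod_(k <- s) fine (Pr (X k @^-1` B k)).
rewrite (integral_mul_comp (c := c) (X := W) (g := fun y => `|y|))//.
- rewrite [RHS]EFinM -EW; congr (_ * _)%E.
  by apply: eq_integral => w _; rewrite ger0_norm.
- exact: mind.
- by move=> w; rewrite indE.
- by apply: prodr_ge0 => k _; exact: fine_ge0.
- move=> C mC; rewrite -PrE.
  have mC' : measurable (W @^-1` C) by rewrite -[X in measurable X]setTI; exact: mW.
  rewrite -(reward_indep_past hr t0 (evt_reward s mB) (hW mC)).
  transitivity (\int[Pr]_w (\1_(evt B s `&` W @^-1` C) w)%:E)%E.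
    by apply: eq_integral => w _; rewrite indE indicI.
  by rewrite integral_indic ?setIT//; apply: measurableI => //; exact: mevt.
Qed.

Context (g : 'I_M -> R -> R) (e : 'I_M -> R).
Hypothesis mg : forall k, measurable_fun setT (g k).
Hypothesis g0 : forall k y, 0 <= g k y.
Hypothesis Eg : forall k, (\int[Pr]_w (g k (X k w))%:E = (e k)%:E)%E.

Let e0 k : 0 <= e k.
Proof. by rewrite -lee_fin -Eg; apply: integral_ge0 => w _; rewrite lee_fin. Qed.

Let cW0 : 0 <= cW.
Proof. by rewrite -lee_fin -EW; apply: integral_ge0 => w _; rewrite lee_fin. Qed.

Let mprodg s : measurable_fun setT (fun w => \prod_(k <- s) g k (X k w)).
Proof.
apply: measurable_prod => k _.
exact: (measurableT_comp (mg k) (mX k)).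
Qed.

(** Variables are moved one at a time from the list of indicators to the list of
    functions, which is why both lists occur. *)
Let integral_factor_ind s1 s2 B :
  uniq (s1 ++ s2) -> (forall k, measurable (B k)) ->
  (\int[Pr]_w (ind B s2 w * W w * \prod_(k <- s1) g k (X k w))%:E
   = (\prod_(k <- s2) fine (Pr (X k @^-1` B k)) * cW * \prod_(k <- s1) e k)%:E)%E.
Proof.
elim: s1 s2 B => [|k s1 IH] s2 B us mB.
  rewrite big_nil mulr1 -integral_ind//.
  by apply: eq_integral => w _; rewrite big_nil mulr1.
move: us; rewrite cat_cons => /=/andP[ks us].
pose H w := ind B s2 w * W w * \prod_(k <- s1) g k (X k w).
have -> : (\int[Pr]_w (ind B s2 w * W w * \prod_(k <- k :: s1) g k (X k w))%:E
           = \int[Pr]_w (H w * g k (X k w))%:E)%E.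
  by apply: eq_integral => w _; rewrite big_cons /H; congr _%:E; ring.
set c := \prod_(k <- s2) fine (Pr (X k @^-1` B k)) * cW * \prod_(k <- s1) e k.
rewrite (integral_mul_comp (c := c))//.
- by rewrite Eg -EFinM big_cons /c; congr _%:E; ring.
- apply: measurable_funM; last exact: mprodg.
  by apply: measurable_funM => //; exact: mind.
- move=> w; rewrite /H indE !mulr_ge0//.
  by apply: prodr_ge0.
- rewrite /c !mulr_ge0//; first by apply: prodr_ge0 => j _; exact: fine_ge0.
  by apply: prodr_ge0.
- move=> C mC; pose B' j := if j == k then C else B j.
  have mB' j : measurable (B' j) by rewrite /B'; case: ifP.
  have us' : uniq (s1 ++ k :: s2).
    by rewrite -cat1s uniq_catCA/= ks us.
  have kk : k \notin s2 by move: ks; rewrite mem_cat negb_or => /andP[].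
  have BB j : j \in s2 -> B' j = B j.
    by rewrite /B'; case: eqVneq => // -> /(negP kk).
  have := IH (k :: s2) B' us' mB'.
  rewrite big_cons.
  have -> : \prod_(j <- s2) fine (Pr (X j @^-1` B' j))
            = \prod_(j <- s2) fine (Pr (X j @^-1` B j)).
    by rewrite big_seq [RHS]big_seq; apply: eq_bigr => j /BB ->.
  have -> : B' k = C by rewrite /B' eqxx.
  have -> : (c%:E * Pr (X k @^-1` C) = (fine (Pr (X k @^-1` C))
      * \prod_(j <- s2) fine (Pr (X j @^-1` B j)) * cW * \prod_(j <- s1) e j)%:E)%E.
    rewrite -[Pr _ in LHS]fineK ?fin_num_measure//; last exact: measurable_preX.
    by rewrite -EFinM /c; congr _%:E; ring.
  move=> <-; apply: eq_integral => w _; rewrite /H /ind big_cons.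
  have -> : B' k = C by rewrite /B' eqxx.
  have -> : \prod_(j <- s2) \1_(B' j) (X j w) = \prod_(j <- s2) \1_(B j) (X j w) :> R.
    by rewrite big_seq [RHS]big_seq; apply: eq_bigr => j /BB ->.
  by congr _%:E; ring.
Qed.

(** What one step of the supermartingale uses: W carries the past and the current
    selections, the list s the agents that sample arm i now. *)
Lemma integral_factor s : uniq s ->
  (\int[Pr]_w (W w * \prod_(k <- s) g k (X k w))%:E
   = (cW * \prod_(k <- s) e k)%:E)%E.
Proof.
move=> us.
have := @integral_factor_ind s [::] (fun=> setT).
rewrite cats0 big_nil mul1r => <-//.
by apply: eq_integral => w _; rewrite /ind big_nil mul1r.
Qed.

End Factor.

Definition selects (i : 'I_N) (s : nat) (k : 'I_M) (w : Om) : R :=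
  (sel k s.+1 w == i)%:R.

Definition reward (i : 'I_N) (s : nat) (k : 'I_M) (w : Om) : R := r i k s.+1 w.

(** The rewards recorded in the history; [reward] itself is not part of it when
    the arm is not selected, but [tilt] only reads it when it is. *)
Let measured (s : nat) (k : 'I_M) (w : Om) : R := r (sel k s.+1 w) k s.+1 w.

Let selectsE i s k : selects i s k = \1_(sel k s.+1 @^-1` [set i]).
Proof.
apply/funext => w; rewrite /selects indicE; congr _%:R.
by case: eqP => h; [rewrite mem_set|rewrite memNset].
Qed.

Lemma measurable_selects i s k : measurable_fun setT (selects i s k).
Proof. by rewrite selectsE; apply: measurable_indic; exact: hsel. Qed.

Lemma measurable_reward i s k : measurable_fun setT (reward i s k).
Proof. exact: measurable_funPT. Qed.

Let tilt_measured mu i b t :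
  tilt sigma mu (selects i) (reward i) b t = tilt sigma mu (selects i) measured b t.
Proof.
apply/funext => w; congr expR; apply: eq_bigr => s _; apply: eq_bigr => k _.
rewrite /selects /reward /measured; case: eqP => [->//|_].
by rewrite !mul0r.
Qed.

Let pattern i (A : {set 'I_M}) s (w : Om) : R :=
  \prod_k (if k \in A then selects i s k w else 1 - selects i s k w).

Let pattern_ge0 i A s w : 0 <= pattern i A s w.
Proof.
apply: prodr_ge0 => k _; rewrite /selects.
by case: ifP => _; case: eqP; rewrite ?subr0 ?subrr.
Qed.

(** The set of agents that select the arm is random but known before the rewards
    are drawn: the new factor is expanded over its possible values A. *)
Let tiltS mu i b t w : tilt sigma mu (selects i) (reward i) b t.+1 w
  = \sum_(A in {set 'I_M}) (tilt sigma mu (selects i) (reward i) b t w * pattern i A t w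
     * \prod_(k <- enum A)
         expR (b t k * (reward i t k w - mu) - sigma ^+ 2 * b t k ^+ 2 / 2)).
Proof.
rewrite {1}/tilt big_ord_recr/= expRD -/(tilt _ _ _ _ _ _ _).
under [RHS]eq_bigr do rewrite -mulrA.
rewrite -mulr_sumr; congr (_ * _); rewrite expR_sum.
pose g k := expR (b t k * (reward i t k w - mu) - sigma ^+ 2 * b t k ^+ 2 / 2).
transitivity (\prod_k (selects i t k w * g k + (1 - selects i t k w))).
  apply: eq_bigr => k _; rewrite /selects; case: eqP => _.
    by rewrite !mul1r subrr addr0.
  by rewrite !mul0r expR0 add0r subr0.
rewrite bigA_distr; apply: eq_bigr => A _.
rewrite big_enum_cond/= [X in _ * X]big_mkcond/= -big_split/=.
by apply: eq_bigr => k _; rewrite andbT; case: ifP => _//; rewrite mulr1.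
Qed.

(** One step of the supermartingale: given the history, each sampled reward
    contributes a factor of mean at most 1 by the sub-Gaussian bound, and the
    patterns A partition the sample space. *)
Lemma integral_tilt_le1 i b t :
  (\int[Pr]_w (tilt sigma (m i) (selects i) (reward i) b t w)%:E <= 1)%E.
Proof.
elim: t => [|t IH].
  rewrite /tilt; under eq_integral do rewrite big_ord0 expR0.
  by rewrite integral_cst// mul1e probability_le1.
set Z := tilt _ _ _ _ _ in IH *.
have mZ : measurable_fun setT (Z t).
  apply: measurable_tilt => s k _; first exact: measurable_selects.
  exact: measurable_reward.
have mpat A : measurable_fun setT (pattern i A t).
  apply: measurable_prod => k _; case: (k \in A); first exact: measurable_selects.
  by apply: measurable_funB => //; exact: measurable_selects.
pose g k y := expR (b t k * (y - m i) - sigma ^+ 2 * b t k ^+ 2 / 2).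
have mg k : measurable_fun setT (g k).
  apply: measurableT_comp => //; apply: measurable_funB => //.
  by apply: measurable_funM => //; exact: measurable_funB.
pose W A w := Z t w * pattern i A t w.
have mW A : measurable_fun setT (W A) by exact: measurable_funM.
have W0 A w : 0 <= W A w by rewrite mulr_ge0// expR_ge0.
have WE : (\sum_(A in {set 'I_M}) \int[Pr]_w (W A w)%:E = \int[Pr]_w (Z t w)%:E)%E.
  rewrite -ge0_integral_sum//.
  - apply: eq_integral => w _; rewrite sumEFin -mulr_sumr -bigA_distr.
    by rewrite big1 ?mulr1// => k _; rewrite /= addrCA subrr addr0.
  - by move=> A; apply/measurable_EFinP; exact: mW.
  - by move=> A w _; rewrite lee_fin.
have hist A B : measurable B ->
    history sel (fun i k t => r i k t : Om -> R) t.+1 (W A @^-1` B).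
  move=> mB; rewrite /history; set GH := [set A | _ \/ _].
  pose T' := g_sigma_algebraType GH.
  have msel s k : (s < t.+1)%N ->
      measurable_fun (setT : set T') (selects i s k : T' -> R).
    move=> st; rewrite selectsE; apply: (@measurable_indic _ T').
    by apply: sub_sigma_algebra; left; exists k, s.+1, i.
  have mrew s k : (s < t)%N ->
      measurable_fun (setT : set T') (measured s k : T' -> R).
    move=> st _ C mC; rewrite setTI; apply: sub_sigma_algebra; right.
    by exists k, s.+1, C.
  have : measurable_fun (setT : set T') (W A : T' -> R).
    apply: measurable_funM.
      rewrite /Z tilt_measured; apply: (@measurable_tilt _ _ _ _ _ T').
        by move=> s k st; apply: msel; rewrite ltnS ltnW.
      by move=> s k; exact: mrew.
    apply: measurable_prod => k _; case: (k \in A); first exact: msel.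
    by apply: measurable_funB => //; exact: msel.
  by move=> /(_ measurableT B mB); rewrite setTI.
have fin A : exists cA : R, (\int[Pr]_w (W A w)%:E = cA%:E)%E.
  exists (fine (\int[Pr]_w (W A w)%:E)%E); rewrite fineK// ge0_fin_numE.
    apply: le_lt_trans (ltry 1); apply: le_trans IH; rewrite -WE.
    rewrite (bigD1 A)//= leeDl//; apply: sume_ge0 => A' _.
    by apply: integral_ge0 => w _; rewrite lee_fin.
  by apply: integral_ge0 => w _; rewrite lee_fin.
have Eg k : exists2 e : R,
    (\int[Pr]_w (g k (reward i t k w))%:E = e%:E)%E & 0 <= e <= 1.
  have h := integral_expR_le (b t k) (reward_sub_gaussian hr i k (ltn0Sn t)).
  have h0 : (0 <= \int[Pr]_w (g k (reward i t k w))%:E)%E.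
    by apply: integral_ge0 => w _; rewrite lee_fin expR_ge0.
  have hf : (\int[Pr]_w (g k (reward i t k w))%:E \is a fin_num)%E.
    by rewrite ge0_fin_numE//; apply: le_lt_trans (ltry 1).
  exists (fine (\int[Pr]_w (g k (reward i t k w))%:E)%E); first by rewrite fineK.
  by rewrite -!lee_fin fineK// h0.
have [e ee e01] : exists2 e : 'I_M -> R,
    forall k, (\int[Pr]_w (g k (reward i t k w))%:E = (e k)%:E)%E &
    forall k, 0 <= e k <= 1.
  have Eg' k : exists e : R,
      (\int[Pr]_w (g k (reward i t k w))%:E = e%:E)%E /\ 0 <= e <= 1.
    by have [e] := Eg k; exists e.
  by have [e he] := choice Eg'; exists e => k; have [] := he k.
apply: le_trans IH; rewrite -WE.
under eq_integral do rewrite /Z tiltS.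
rewrite (eq_integral (fun w => \sum_(A in {set 'I_M})
  (W A w * \prod_(k <- enum A) g k (reward i t k w))%:E)%E); last first.
  by move=> w _; rewrite sumEFin.
rewrite ge0_integral_sum//.
- apply: lee_sum => A _; have [cA cAE] := fin A.
  have c0 : 0 <= cA.
    by rewrite -lee_fin -cAE; apply: integral_ge0 => w _; rewrite lee_fin.
  rewrite (integral_factor (i := i) (ltn0Sn t)
    (mW A) (W0 A) (hist A) cAE mg _ ee) ?enum_uniq//.
    rewrite cAE lee_fin ler_piMr//; apply: prodr_ile1 => k _.
    exact: e01.
  by move=> k y; exact: expR_ge0.
- move=> A; apply/measurable_EFinP; apply: measurable_funM => //.
  apply: measurable_prod => k _.
  exact: (measurableT_comp (mg k) (measurable_reward i t k)).
- move=> A w _; rewrite lee_fin mulr_ge0//.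
  by apply: prodr_ge0 => k _; exact: expR_ge0.
Qed.

End RewardModel.

(** * Series, and peeling over geometric cells *)

Section Series.
Context (R : realType).
Implicit Types (a y : R) (n : nat).

Definition decay (a : R) (n : nat) : R := expR (- a * ln n%:R).

Lemma decay_ge0 a n : 0 <= decay a n.
Proof. exact: expR_ge0. Qed.

Lemma decayD a b n : decay (a + b) n = decay a n * decay b n.
Proof. by rewrite /decay -expRD; congr expR; ring. Qed.

Lemma decay1 n : (0 < n)%N -> decay 1 n = n%:R^-1.
Proof.
by move=> n0; rewrite /decay mulN1r expRN lnK// posrE ltr0n.
Qed.

Lemma lnS_gap n : (0 < n)%N -> ln n%:R + n.+1%:R^-1 <= ln n.+1%:R :> R.
Proof.
move=> n0; have n0' : 0 < n%:R :> R by rewrite ltr0n.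
have s0 : 0 < n.+1%:R :> R by rewrite ltr0n.
have e : n%:R = n.+1%:R * (1 - n.+1%:R^-1) :> R.
  by rewrite mulrBr mulr1 mulfV ?gt_eqF// -[n.+1%:R]natr1 addrK.
have p0 : 0 < 1 - n.+1%:R^-1 :> R by move: n0'; rewrite e pmulr_rgt0.
rewrite {1}e lnM ?posrE// -addrA gerDl -lerBrDr sub0r.
by apply: le_ln1Dx; rewrite ltrNl opprK -subr_gt0.
Qed.

(** The discrete form of the integral of s^-(1+a), from
    ln(n+1) - ln n >= 1/(n+1) and exp x >= 1 + x. *)
Lemma decay_telescope a n : 0 < a -> (0 < n)%N ->
  decay (1 + a) n.+1 <= (decay a n - decay a n.+1) / a.
Proof.
move=> a0 n0; rewrite ler_pdivlMr// lerBrDr decayD decay1//.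
have -> : n.+1%:R^-1 * decay a n.+1 * a + decay a n.+1
    = decay a n.+1 * (1 + a * n.+1%:R^-1) by ring.
apply: (@le_trans _ _ (decay a n.+1 * expR (a * n.+1%:R^-1))).
  by rewrite ler_wpM2l ?decay_ge0// expR_ge1Dx.
rewrite -expRD ler_expR -subr_ge0.
rewrite (_ : _ - _ = a * (ln n.+1%:R - (ln n%:R + n.+1%:R^-1))); last by ring.
by rewrite mulr_ge0 ?(ltW a0)// subr_ge0 lnS_gap.
Qed.

Lemma sum_decay_le a n : 0 < a ->
  \sum_(1 <= s < n) decay (1 + a) s.+1 <= a^-1.
Proof.
move=> a0; case: n => [|n]; first by rewrite big_geq// invr_ge0 ltW.
apply: (@le_trans _ _ ((1 - decay a n.+1) / a)); last first.
  by rewrite ler_pdivrMr// mulVf ?gt_eqF// gerBl decay_ge0.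
elim: n => [|n IH].
  by rewrite big_geq// /decay ln1 mulr0 expR0 subrr mul0r.
rewrite big_nat_recr//=; apply: le_trans (lerD IH (decay_telescope a0 _)) _ => //.
by rewrite -mulrDl ler_wpM2r ?invr_ge0 ?(ltW a0)//; lra.
Qed.

Lemma two_mul_le_expR y : 0 <= y -> 2 * y <= expR y.
Proof.
move=> y0; have h := expR_ge1Dx (y / 2).
have -> : expR y = expR (y / 2) ^+ 2 by rewrite -expRM_natl; congr expR; field.
have h2 : (1 + y / 2) ^+ 2 <= expR (y / 2) ^+ 2.
  by rewrite ler_sqr// nnegrE ?expR_ge0//; lra.
by apply: le_trans h2; have := sqr_ge0 (1 - y / 2); lra.
Qed.

(** Half of the exponent absorbs the logarithm. *)
Lemma ln_mul_decay_le a n : 0 < a -> (0 < n)%N ->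
  ln n%:R * decay (1 + a) n <= decay (1 + a / 2) n / a.
Proof.
move=> a0 n0; rewrite ler_pdivlMr//.
have l0 : 0 <= ln n%:R :> R by rewrite ln_ge0// ler1n.
have h : a * ln n%:R <= expR (a / 2 * ln n%:R).
  apply: le_trans (two_mul_le_expR _); last by rewrite mulr_ge0// divr_ge0 ?ltW.
  by rewrite le_eqVlt; apply/orP; left; apply/eqP; field.
have -> : ln n%:R * decay (1 + a) n * a = a * ln n%:R * decay (1 + a) n by ring.
apply: le_trans (ler_wpM2r (decay_ge0 _ _) h) _.
by rewrite /decay -expRD ler_expR; lra.
Qed.

Lemma weighted_series_le a L c n : 0 < a -> 0 < L -> 0 <= c ->
  \sum_(1 <= s < n) (ln s.+2%:R + c) / L * decay (1 + a) s.+1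
  <= (2 / a ^+ 2 + 1 + c / a) / L.
Proof.
move=> a0 L0 c0.
apply: (@le_trans _ _ (\sum_(1 <= s < n) (decay (1 + a / 2) s.+1 / a
    + decay (1 + (1 + a)) s.+1 + c * decay (1 + a) s.+1) / L)).
  apply: ler_sum_nat => s /andP[s1 _]; rewrite mulrAC ler_wpM2r ?invr_ge0 ?(ltW L0)//.
  rewrite mulrDl lerD2r; apply: le_trans _ (lerD (ln_mul_decay_le a0 _) (lexx _)) => //.
  rewrite [decay (1 + (1 + a)) _]decayD decay1// -mulrDl ler_wpM2r ?decay_ge0//.
  have h : s.+2%:R = s.+1%:R * (1 + s.+1%:R^-1) :> R.
    by rewrite mulrDr mulr1 mulfV ?pnatr_eq0// natr1.
  have i0 : 0 < s.+1%:R^-1 :> R by rewrite invr_gt0 ltr0n.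
  have i1 : 0 < 1 + s.+1%:R^-1 :> R by rewrite addr_gt0.
  rewrite h lnM ?posrE ?ltr0n//.
  by rewrite lerD2l le_ln1Dx// (lt_trans (ltrN10 R) i0).
rewrite -mulr_suml ler_wpM2r ?invr_ge0 ?(ltW L0)// !big_split/= -mulr_suml -mulr_sumr.
apply: lerD; first apply: lerD.
- have a2 : 0 < a / 2 by rewrite divr_gt0.
  have -> : 2 / a ^+ 2 = (a / 2)^-1 / a by field; rewrite gt_eqF.
  by rewrite ler_wpM2r ?invr_ge0 ?(ltW a0)// sum_decay_le.
- have a1 : 0 < 1 + a by rewrite addr_gt0.
  by apply: le_trans (sum_decay_le _ a1) _; rewrite invf_le1// lerDl ltW.
- by rewrite ler_wpM2l// sum_decay_le.
Qed.

End Series.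

Section Peeling.
Context (R : realType) (sigma gamma eta : R).
Hypotheses (hsigma : 0 < sigma) (hgamma : 1 < gamma) (heta : 0 < eta < 4).

Let e0 : 0 < eta. Proof. by case/andP: heta. Qed.
Let e4 : eta < 4. Proof. by case/andP: heta. Qed.

Lemma G_gt0 : 0 < G eta.
Proof.
rewrite /G subr_gt0 ltr_pdivrMr// mul1r.
have -> : 16%:R = 4 ^+ 2 :> R by rewrite -natrX.
by rewrite ltr_pXn2r// nnegrE ltW.
Qed.

(** The optimal parameter for a variance proxy equal to y, at the deviation
    sigma sqrt(2 gamma l y / G(eta)). *)
Definition peel_beta (l y : R) : R := Num.sqrt (2 * gamma / G eta * l / y) / sigma.

(** Bernoulli: (1 + eta/4)^4 >= 1 + eta, and dually (1 - eta/4)^4 (1 + eta) <= 1. *)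
Lemma near_one_of_pow4 (q : R) : 0 <= q ->
  (1 + eta)^-1 <= q ^+ 4 <= 1 + eta -> (q - 1) ^+ 2 <= eta ^+ 2 / 16.
Proof.
move=> q0 /andP[h1 h2]; have /andP[eta0 eta4] := heta.
have E : 0 < 1 + eta by rewrite addr_gt0.
have qU : q <= 1 + eta / 4.
  have x0 : 0 <= 1 + eta / 4 by rewrite addr_ge0// divr_ge0// ltW.
  rewrite -(@ler_pXn2r _ 4)// ?nnegrE//; apply: le_trans h2 _.
  have : 0 < eta / 4 by rewrite divr_gt0.
  have -> : 1 + eta = 1 + 4 * (eta / 4) by field.
  set x := eta / 4 => {}x0.
  rewrite -subr_ge0.
  have -> : (1 + x) ^+ 4 - (1 + 4 * x) = x ^+ 2 * (6 + 4 * x + x ^+ 2) by ring.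
  by rewrite mulr_ge0 ?sqr_ge0//; nra.
have qL : 1 - eta / 4 <= q.
  have x1 : 0 <= 1 - eta / 4 by rewrite subr_ge0 ler_pdivrMr//; lra.
  rewrite -(@ler_pXn2r _ 4)// ?nnegrE//; apply: le_trans h1.
  rewrite -[leRHS]mul1r ler_pdivlMr//.
  have : 0 < eta / 4 by rewrite divr_gt0.
  have -> : 1 + eta = 1 + 4 * (eta / 4) by field.
  set x := eta / 4 in x1 * => x0.
  rewrite -subr_ge0.
  have -> : 1 - (1 - x) ^+ 4 * (1 + 4 * x)
     = x ^+ 2 * (10 - 20 * x + 15 * x ^+ 2 - 4 * x ^+ 3) by ring.
  rewrite mulr_ge0 ?sqr_ge0//.
  have -> : 10 - 20 * x + 15 * x ^+ 2 - 4 * x ^+ 3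
     = (1 - x) * (10 - 10 * x + 5 * x ^+ 2) + x ^+ 3 by ring.
  rewrite addr_ge0 ?exprn_ge0 ?(ltW x0)// mulr_ge0//; nra.
have -> : eta ^+ 2 / 16 = (eta / 4) ^+ 2 by field.
by rewrite -subr_ge0 subr_sqr; apply: mulr_ge0; lra.
Qed.

(** With q = sqrt(Y / y) and D^2 = 2 gamma l / G(eta), the exponent is at least
    D^2 (q - q^2 / 2) = D^2 (1 - (1 - q)^2) / 2, and |1 - q| <= eta / 4 in a cell
    of ratio 1 + eta around y: this is the origin of G(eta). *)
Lemma peel_cell (l y Y V S : R) : 0 <= l -> 0 < y -> 0 < Y ->
  (1 + eta)^-1 <= (Y / y) ^+ 2 <= 1 + eta -> V <= Y ->
  sigma * Num.sqrt (2 * gamma / G eta * l * Y) <= S ->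
  gamma * l <= peel_beta l y * S - sigma ^+ 2 * peel_beta l y ^+ 2 / 2 * V.
Proof.
move=> l0 y0 Y0 hq VY hS; have G0 := G_gt0.
have s0 : sigma != 0 by rewrite gt_eqF.
set D2 := 2 * gamma / G eta * l in hS *.
have D20 : 0 <= D2.
  by rewrite mulr_ge0// divr_ge0 ?ltW// mulr_gt0// (lt_trans ltr01).
have b0 : 0 <= peel_beta l y by rewrite divr_ge0 ?sqrtr_ge0// ltW.
pose q := Num.sqrt (Y / y).
have q2 : q ^+ 2 = Y / y by rewrite sqr_sqrtr// divr_ge0 ?ltW.
have hb : sigma ^+ 2 * peel_beta l y ^+ 2 = D2 / y.
  rewrite /peel_beta -/D2 expr_div_n sqr_sqrtr; last by rewrite divr_ge0// ltW.
  by field; rewrite s0 gt_eqF.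
have h1 : D2 * q <= peel_beta l y * S.
  apply: le_trans (ler_wpM2l b0 hS); rewrite /peel_beta -/D2.
  rewrite le_eqVlt; apply/orP; left; apply/eqP.
  rewrite mulrA divfK// /q !(sqrtrM _ D20) (sqrtrM _ (ltW Y0)).
  by rewrite -[X in X * _ = _](sqr_sqrtr D20); ring.
have h2 : sigma ^+ 2 * peel_beta l y ^+ 2 / 2 * V <= D2 * q ^+ 2 / 2.
  rewrite hb q2; have -> : D2 * (Y / y) / 2 = D2 / y / 2 * Y by ring.
  by rewrite ler_wpM2l// !divr_ge0// ltW.
have := @near_one_of_pow4 q; rewrite sqrtr_ge0 => /(_ isT).
have -> : q ^+ 4 = (Y / y) ^+ 2 by rewrite -q2 -exprM.
move=> /(_ hq) h3.
have h4 : D2 * (G eta / 2) <= D2 * (q - q ^+ 2 / 2).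
  by rewrite ler_wpM2l// /G; lra.
have -> : gamma * l = D2 * (G eta / 2) by rewrite /D2; field; rewrite gt_eqF.
lra.
Qed.

Definition cells (rho : R) : nat := (Num.truncn (ln rho / ln (1 + eta))).+1.

Definition cell_center (y0 : R) (p : nat) : R :=
  y0 * expR (ln (1 + eta) * (p%:R + 2^-1)).

Let L0 : 0 < ln (1 + eta). Proof. by rewrite ln_gt0// ltrDl. Qed.

Lemma cells_le rho : 1 <= rho ->
  (cells rho)%:R <= (ln rho + ln (1 + eta)) / ln (1 + eta).
Proof.
move=> r1; rewrite mulrDl mulfV ?gt_eqF// -natr1 lerD2r truncn_le.
by rewrite divr_ge0 ?(ltW L0) ?ln_ge0.
Qed.

Lemma exists_cell (y0 Y rho : R) : 0 < y0 -> y0 <= Y <= y0 * rho ->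
  exists2 p, (p < cells rho)%N &
    (1 + eta)^-1 <= (Y / cell_center y0 p) ^+ 2 <= 1 + eta.
Proof.
move=> y00 /andP[h1 h2].
have Y0 : 0 < Y by exact: lt_le_trans h1.
have v1 : 1 <= Y / y0 by rewrite ler_pdivlMr// mul1r.
have v0 : 0 < Y / y0 by exact: lt_le_trans v1.
have vr : Y / y0 <= rho by rewrite ler_pdivrMr// mulrC.
set L := ln (1 + eta).
have x0 : 0 <= ln (Y / y0) / L by rewrite divr_ge0 ?(ltW L0) ?ln_ge0.
exists (Num.truncn (ln (Y / y0) / L)).
  rewrite ltnS; apply: le_truncn; rewrite ler_wpM2r ?invr_ge0 ?(ltW L0)//.
  by rewrite ler_ln// posrE// (lt_le_trans v0).
have := truncn_itv x0; set p := Num.truncn _ => /andP[p1 p2].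
move: p1; rewrite ler_pdivlMr// => p1.
move: p2; rewrite ltr_pdivrMr// -natr1 => p2.
have -> : (Y / cell_center y0 p) ^+ 2
    = expR (2 * ln (Y / y0) - 2 * (L * (p%:R + 2^-1))).
  rewrite /cell_center -/L expRB !expRM_natl lnK ?posrE// -expr_div_n.
  by congr (_ ^+ 2); field; rewrite !gt_eqF ?expR_gt0.
have E0 : 0 < 1 + eta by rewrite addr_gt0.
rewrite -[X in X^-1]lnK ?posrE// -expRN -[X in _ <= _ <= X]lnK ?posrE// -/L.
by rewrite !ler_expR; apply/andP; split; lra.
Qed.

Lemma peeling (l y0 Y rho V S : R) : 0 <= l -> 0 < y0 ->
  y0 <= Y <= y0 * rho -> V <= Y ->
  sigma * Num.sqrt (2 * gamma / G eta * l * Y) <= S ->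
  1 <= \sum_(p < cells rho) expR (- gamma * l) *
    expR (peel_beta l (cell_center y0 p) * S
          - sigma ^+ 2 * peel_beta l (cell_center y0 p) ^+ 2 / 2 * V).
Proof.
move=> l0 y00 hY VY hS; have [p pc hp] := exists_cell y00 hY.
have Y0 : 0 < Y by case/andP: hY => h _; exact: lt_le_trans h.
rewrite (bigD1 (Ordinal pc))//= ler_wpDr//.
  by apply: sumr_ge0 => j _; rewrite mulr_ge0 ?expR_ge0.
have c0 : 0 < cell_center y0 p by rewrite mulr_gt0// expR_gt0.
rewrite -expRD; apply: le_trans (expR_ge1Dx _).
rewrite lerDl mulNr [leRHS]addrC subr_ge0.
exact: (peel_cell l0 c0 Y0 hp VY hS).
Qed.

End Peeling.

(** The range of nhat + f(s) over which peeling takes place. With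
    x = min(sqrt eps_c, eps_n), the ratio of the end points is controlled by
    (1 + x)(1 - x + x^2) = 1 + x^3 >= 1. *)
Lemma count_range (R : rcfType) (en ec f z s : R) :
  0 <= en -> 0 <= ec -> ec <= f -> 0 <= s -> z <= s -> 1 - en <= z ->
  1 - Num.sqrt ec <= z ->
  let y0 := 1 - Num.min (Num.sqrt ec) en + f in
  0 < y0 /\ y0 <= z + f <= y0 * ((s + 1) * (1 + en)).
Proof.
move=> en0 ec0 ecf s0 zs ze zc /=.
set mm := Num.min _ _.
have mx : mm <= Num.sqrt ec by rewrite ge_min lexx.
have me : mm <= en by rewrite ge_min lexx orbT.
have m0 : 0 <= mm by rewrite le_min sqrtr_ge0.
have mz : 1 - mm <= z by rewrite /mm minEle; case: ifP.
have m2 : mm ^+ 2 <= f.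
  apply: le_trans ecf; rewrite -(sqr_sqrtr ec0).
  by rewrite ler_pXn2r// ?nnegrE// sqrtr_ge0.
have y0 : 0 < 1 - mm + mm ^+ 2 by nra.
have yp : 0 < 1 - mm + f by lra.
have k1 : 1 <= (1 + en) * (1 - mm + f).
  apply: (@le_trans _ _ ((1 + mm) * (1 - mm + mm ^+ 2))).
    have -> : (1 + mm) * (1 - mm + mm ^+ 2) = 1 + mm ^+ 3 by ring.
    by rewrite lerDl exprn_ge0.
  by apply: ler_pM; lra.
have k2 : f <= (1 + en) * (1 - mm + f).
  apply: (@le_trans _ _ ((1 + mm) * (1 - mm + f))); last first.
    by rewrite ler_wpM2r//; lra.
  rewrite -subr_ge0 (_ : _ - f = 1 - mm ^+ 2 + mm * f); last by ring.
  have m3 : mm * mm ^+ 2 <= mm * f by rewrite ler_wpM2l.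
  have [m1|m1] := lerP mm 1; first by nra.
  by nra.
split=> //; apply/andP; split; first by lra.
have -> : (1 - mm + f) * ((s + 1) * (1 + en))
   = s * ((1 + en) * (1 - mm + f)) + (1 + en) * (1 - mm + f) by ring.
by apply: lerD => //; apply: le_trans zs _; rewrite ler_peMr.
Qed.

(** * Deterministic facts about graph, schedule, widths and ranks *)

Lemma consensus_matrix_ge0 (R : realType) (M : nat) (e : rel 'I_M) (kappa : R) :
  simple_graph e -> 0 < kappa <= 1 ->
  forall k l, 0 <= consensus_matrix e kappa k l.
Proof.
move=> [_ irr] /andP[k0 k1] k l; rewrite !mxE.
have [->|kl] := eqVneq k l; last first.
  by rewrite !mulr0n !sub0r mulrN opprK mulr_ge0// divr_ge0// ltW.
rewrite !mulr1n irr subr0 subr_ge0.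
have [d0|d0] := posnP (max_degree e); first by rewrite d0 invr0 mulr0 mul0r.
rewrite mulrAC ler_pdivrMr ?ltr0n// mul1r.
apply: le_trans (_ : (degree e l)%:R <= _); first by rewrite ler_piMl.
by rewrite ler_nat /max_degree; exact: (leq_bigmax l).
Qed.

Section Sublogarithmic.
Context (R : realType) (f : R -> R) (hf : increasing_sublogarithmic f).

Lemma increasing_le x y : 1 <= x -> x <= y -> f x <= f y.
Proof.
move=> x1; rewrite le_eqVlt => /predU1P[->//|xy]; apply: ltW.
by apply: hf.1; rewrite ?in_itv/= ?andbT// (le_trans x1)// ltW.
Qed.

Lemma f_inv_spec c : (f @` [set` `[1%R, +oo[]) c -> 1 <= f_inv f c /\ f (f_inv f c) = c.
Proof.
move=> [x x1 <-]; move: x1 => /=; rewrite in_itv/= andbT => x1.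
suff -> : f_inv f (f x) = x by [].
rewrite /f_inv pinvKV ?inE/= ?in_itv/= ?andbT// => y z.
rewrite !inE/= !in_itv/= !andbT => y1 z1 fyz.
have [yz|zy|//] := ltgtP y z.
- have := hf.1 y z; rewrite !in_itv/= !andbT fyz ltxx => /(_ y1 z1 yz).
  by [].
- have := hf.1 z y; rewrite !in_itv/= !andbT fyz ltxx => /(_ z1 y1 zy).
  by [].
Qed.

End Sublogarithmic.

Section RoundRobin.
Local Open Scope nat_scope.
Context (M N : nat) (hMN : (M <= N)%N) (i : 'I_N).

(** The index s at which agent k samples arm i in the round robin, at time
    s + 1. *)
Definition rr_time (k : nat) : nat := (i + (N - k)) %% N.

Let N0 : (0 < N)%N. Proof. exact: leq_ltn_trans (ltn_ord i). Qed.

Lemma rr_time_lt k : (rr_time k < N)%N.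
Proof. by rewrite ltn_mod. Qed.

Lemma rr_timeP (k : 'I_M) s :
  (s < N)%N -> ((s + k) %% N == i :> nat) = (s == rr_time k).
Proof.
move=> sN; have kN : (k < N)%N by exact: leq_trans hMN.
have iN := ltn_ord i.
have -> : ((s + k) %% N == i) = (s + k == i %[mod N]) by rewrite (modn_small iN).
rewrite -(eqn_modDr (N - k)) -addnA subnKC ?(ltnW kN)// modnDr.
by rewrite (modn_small sN).
Qed.

Lemma rr_time_inj (k l : 'I_M) : rr_time k = rr_time l -> k = l.
Proof.
move=> e; have kN : (k < N)%N by exact: leq_trans hMN.
have lN : (l < N)%N by exact: leq_trans hMN.
have h1 : (rr_time k + k) %% N = i by apply/eqP; rewrite rr_timeP ?rr_time_lt.
have h2 : (rr_time k + l) %% N = i by apply/eqP; rewrite rr_timeP ?rr_time_lt// e.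
have : (k == l %[mod N]) by rewrite -(eqn_modDl (rr_time k)) h1 h2.
by rewrite !modn_small// => /eqP/val_inj.
Qed.

End RoundRobin.

(** Only increments starting below X are counted, so the total passes X by at most
    one increment. *)
Lemma sum_capped_le (R : realDomainType) (a : nat -> R) (A X : R) (T : nat) :
  0 <= X -> (forall s, 0 <= a s <= A) ->
  \sum_(s < T) a s * (\sum_(j < s) a j < X)%R%:R <= X + A.
Proof.
move=> X0 aA; have A0 : 0 <= A by have /andP[/le_trans h /h] := aA 0%N.
suff /andP[] : (\sum_(s < T) a s * (\sum_(j < s) a j < X)%R%:R <= \sum_(j < T) a j)
  && (\sum_(s < T) a s * (\sum_(j < s) a j < X)%R%:R <= X + A) by [].
elim: T => [|T /andP[IH1 IH2]]; first by rewrite !big_ord0 lexx addr_ge0.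
rewrite !big_ord_recr/=; have /andP[a0 a1] := aA T.
by have [h|h] := ltrP (\sum_(j < T) a j) X;
  rewrite ?mulr1 ?mulr0; apply/andP; split; lra.
Qed.

Lemma count_below_le (R : realType) (x : R) (T : nat) : 0 <= x ->
  \sum_(s < T) ((0 < s)%N && (s%:R < x))%:R <= x.
Proof.
move=> x0.
have h n : \sum_(s < n.+1) ((0 < s)%N && (s%:R < x))%:R
    <= (minn n (Num.truncn x))%:R :> R.
  elim: n => [|n IH]; first by rewrite big_ord_recr big_ord0 /= add0r.
  rewrite big_ord_recr/=; have [/ltW nx|_] := ltrP n.+1%:R x; last first.
    by rewrite addr0; apply: le_trans IH _; rewrite ler_nat; lia.
  move: nx; rewrite -truncn_ge_nat// => nx.
  by apply: le_trans (lerD IH (lexx _)) _; rewrite natr1 ler_nat; lia.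
case: T => [|T]; first by rewrite big_ord0.
apply: le_trans (h T) _; apply: (@le_trans _ _ (Num.truncn x)%:R).
  by rewrite ler_nat geq_minr.
by rewrite truncn_le.
Qed.

Lemma leading_term_ge0 (R : realType) (M T : nat) (sigma gamma eta Delta : R)
    (f : R -> R) : 0 <= sigma -> 0 <= gamma -> 0 < eta < 4 ->
  0 <= leading_term M T sigma gamma eta Delta f.
Proof.
move=> s0 g0 heta; have G0 := ltW (G_gt0 heta).
have lnT : 0 <= ln T%:R :> R.
  by case: T => [|T]; [rewrite ln0|rewrite ln_ge0// ler1n].
rewrite /leading_term mulr_ge0// mulr_ge0 ?addr_ge0 ?sqrtr_ge0//.
by apply: divr_ge0; apply: mulr_ge0; rewrite ?sqr_ge0// mulr_ge0 ?sqr_ge0.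
Qed.

Section Threshold.
Context (R : realType) (M T : nat) (sigma gamma eta Delta : R) (f : R -> R).
Hypotheses (hM : (0 < M)%N) (hT : (1 < T)%N) (s0 : 0 < sigma) (g1 : 1 < gamma)
  (heta : 0 < eta < 4) (D0 : 0 < Delta).

Let lnT : 0 < ln T%:R :> R. Proof. by rewrite ln_gt0// ltr1n. Qed.

(** With A = 4 sigma^2 gamma ln T / (Delta^2 M G(eta)), the leading term divided
    by M is the positive root A (1 + sqrt(1 + 2 f(T) / A)) of
    n^2 = 2 A (n + f(T)), which is the equality case. *)
Lemma width_le (n l fs : R) : 0 <= l <= ln T%:R -> 0 <= fs <= f T%:R -> 0 < n ->
  leading_term M T sigma gamma eta Delta f / M%:R <= n ->
  2 * (sigma * Num.sqrt (2 * gamma / G eta * ((n + fs) / (M%:R * n)) * (l / n)))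
  <= Delta.
Proof.
move=> /andP[l0 lT] /andP[f0 fF] n0 hn.
have G0 := G_gt0 heta; have g0 : 0 < gamma by rewrite (lt_trans ltr01).
have M0 : 0 < M%:R :> R by rewrite ltr0n.
set F := f T%:R in fF hn *; have F0 : 0 <= F by exact: le_trans fF.
pose A := 4 * sigma ^+ 2 * gamma * ln T%:R / (Delta ^+ 2 * M%:R * G eta).
have A0 : 0 < A by apply: divr_gt0; rewrite !mulr_gt0 ?exprn_gt0.
have z0 : 0 <= 1 + 2 * F / A by rewrite addr_ge0// divr_ge0 ?(ltW A0)// mulr_ge0.
have hn' : A * (1 + Num.sqrt (1 + 2 * F / A)) <= n.
  apply: le_trans hn; rewrite le_eqVlt; apply/orP; left; apply/eqP.
  rewrite /leading_term -/F.
  have -> : Delta ^+ 2 * M%:R * G eta / (2 * sigma ^+ 2 * gamma) * (F / ln T%:R)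
            = 2 * F / A.
    by rewrite /A; field; rewrite !gt_eqF.
  by rewrite /A; field; rewrite !gt_eqF.
have key : 2 * A * (n + F) <= n ^+ 2.
  set q := Num.sqrt _ in hn'.
  have q0 : 0 <= q by exact: sqrtr_ge0.
  have h : (A * q) ^+ 2 <= (n - A) ^+ 2.
    have Aq : 0 <= A * q by rewrite mulr_ge0// ltW.
    by rewrite ler_sqr ?nnegrE//; lra.
  have q2 : (A * q) ^+ 2 = A ^+ 2 + 2 * A * F.
    by rewrite exprMn sqr_sqrtr//; field; rewrite gt_eqF.
  by move: h; rewrite q2; lra.
have z : 2 * gamma / G eta * ((n + fs) / (M%:R * n)) * (l / n)
    <= (Delta / (2 * sigma)) ^+ 2.
  apply: (@le_trans _ _ (2 * gamma / G eta * ((n + F) / (M%:R * n)) * (ln T%:R / n))).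
    have gG : 0 <= 2 * gamma / G eta.
      by apply: divr_ge0; [rewrite mulr_ge0 ?(ltW g0)|exact: ltW].
    have Mn : 0 <= M%:R * n by rewrite mulr_ge0 ?(ltW n0).
    have nf : 0 <= n + fs by rewrite addr_ge0 ?(ltW n0).
    apply: ler_pM.
    - by rewrite (mulr_ge0 gG)// divr_ge0.
    - by rewrite divr_ge0 ?(ltW n0).
    - by apply: (ler_wpM2l gG); rewrite ler_wpM2r ?invr_ge0// lerD2l.
    - by rewrite ler_wpM2r ?invr_ge0 ?(ltW n0).
  have -> : 2 * gamma / G eta * ((n + F) / (M%:R * n)) * (ln T%:R / n)
     = (Delta / (2 * sigma)) ^+ 2 * (2 * A * (n + F) / n ^+ 2).
    by rewrite /A; field; rewrite !gt_eqF.
  rewrite ler_piMr ?sqr_ge0// ler_pdivrMr ?exprn_gt0// mul1r//.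
apply: (@le_trans _ _ (2 * (sigma * (Delta / (2 * sigma))))).
  rewrite ler_wpM2l// ler_wpM2l ?(ltW s0)//.
  have d0 : 0 <= Delta / (2 * sigma) by rewrite divr_ge0 ?mulr_ge0 ?(ltW s0) ?(ltW D0).
  by rewrite -[leRHS](ger0_norm d0) -sqrtr_sqr; apply: ler_wsqrtr.
by rewrite le_eqVlt; apply/orP; left; apply/eqP; field; rewrite gt_eqF.
Qed.

End Threshold.

Section Ranks.
Context (R : realType) (N : nat) (m : 'I_N -> R) (b : 'S_N) (hb : ranks_arms m b).

Lemma mean_rank_lt (j l : 'I_N) : (m (b l) < m (b j)) = (j < l)%N.
Proof.
apply/idP/idP => [h|]; last exact: hb.
rewrite ltnNge; apply/negP; rewrite leq_eqVlt => /predU1P[/val_inj e|/hb/ltW].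
  by rewrite e ltxx in h.
by rewrite leNgt h.
Qed.

Lemma mean_gap (i j : 'I_N) : i != j -> Delta_min m <= `|m i - m j|.
Proof.
move=> ij; apply: ge_inf; last by exists i, j.
by exists 0 => _ [x [y [_ ->]]].
Qed.

Lemma Delta_min_gt0 : (1 < N)%N -> 0 < Delta_min m.
Proof.
move=> N1.
have inj (i j : 'I_N) : i != j -> 0 < `|m i - m j|.
  move=> ij; rewrite normr_gt0 subr_eq0; apply/negP => /eqP mij.
  have := mean_rank_lt (b^-1%g i) (b^-1%g j).
  have := mean_rank_lt (b^-1%g j) (b^-1%g i).
  rewrite !permKV mij ltxx => /esym/negbT + /esym/negbT.
  rewrite -!leqNgt => h1 h2; have : b^-1%g i = b^-1%g j.
    by apply/val_inj/anti_leq/andP.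
  by move/perm_inj => e; rewrite e eqxx in ij.
have N0 : (0 < N)%N by exact: ltnW.
pose p0 : 'I_N * 'I_N := (Ordinal N0, Ordinal N1).
pose F (p : 'I_N * 'I_N) := `|m p.1 - m p.2|.
have [p pP pmin] := @arg_minP _ _ _ p0 (fun p => p.1 != p.2) F isT.
apply: lt_le_trans (inj p.1 p.2 pP) _; apply: lb_le_inf.
  by exists (F p0), p0.1, p0.2.
by move=> _ [i [j [ij ->]]]; exact: (pmin (i, j)).
Qed.

(** The direction of the estimation error of arm h that can explain that agent k
    selects i: if i is worse than the target, i must be overestimated or another
    arm underestimated, and conversely if i is better. *)
Definition err_sign (k i h : 'I_N) : R :=
  (-1) ^+ ((m i < m (b k)) (+) (h == i)).

(** If i is worse than b k, some arm h among the k + 1 best is left out of O, and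
    Q_h <= Q_i. If i is better, O contains some h outside the k best, and
    W_i <= W_h. Without errors either comparison contradicts the gap between m_i
    and m_h. *)
Lemma selection_error (k i : 'I_N) (mu C : 'I_N -> R) (O : {set 'I_N}) :
  i != b k -> 2 * C i <= Delta_min m ->
  top_arms (fun h => mu h + C h) k.+1 O ->
  argmin_in (fun h => mu h - C h) O i ->
  exists h, C h <= err_sign k i h * (mu h - m h).
Proof.
move=> ik Ci [Ok Otop] [iO imin]; apply: contrapT => /forallNP noerr.
have {}noerr h : err_sign k i h * (mu h - m h) < C h.
  by rewrite ltNge; exact/negP.
have cardB (j : nat) : (j <= N)%N -> #|best_arms b j| = j.
  move=> jN; rewrite card_imset; last exact: perm_inj.
  rewrite -sum1_card -[RHS]muln1 -{2}[j]card_ord -sum_nat_const.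
  rewrite (big_ord_widen N (fun=> 1%N) jN).
  by apply: eq_bigl => l; rewrite inE.
have [mik|mik] := ltP (m i) (m (b k)).
  have iB : i \notin best_arms b k.+1.
    apply/negP => /imsetP[l]; rewrite inE ltnS => lk e.
    by move: mik; rewrite e mean_rank_lt ltnNge lk.
  have [h hB hO] : exists2 h, h \in best_arms b k.+1 & h \notin O.
    apply/subsetPn; apply/negP => BO.
    have /eqP E : best_arms b k.+1 == O.
      by rewrite eqEcard BO Ok cardB ?ltn_ord//=.
    by rewrite E iO in iB.
  have hi : h != i by apply: contraNneq iB => <-.
  have mh : m (b k) <= m h.
    case/imsetP: hB => l; rewrite inE ltnS => lk ->.
    by rewrite leNgt mean_rank_lt -leqNgt.
  have := noerr h; rewrite /err_sign mik (negbTE hi) addbF expr1.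
  have := noerr i; rewrite /err_sign mik eqxx addbb expr0.
  have := Otop i h iO hO; have := mean_gap hi.
  rewrite ger0_norm; last by rewrite subr_ge0 ltW// (lt_le_trans mik).
  lra.
have {}mik : m (b k) < m i.
  rewrite lt_neqAle mik andbT; apply: contra ik => /eqP e.
  have := mean_rank_lt (b^-1%g i) k; have := mean_rank_lt k (b^-1%g i).
  rewrite permKV e !ltxx => /esym/negbT + /esym/negbT.
  rewrite -!leqNgt => h1 h2; apply/eqP; rewrite -[i](permKV b); congr (b _).
  by apply/val_inj/anti_leq/andP.
have [h hO hB] : exists2 h, h \in O & h \notin best_arms b k.
  apply/subsetPn; apply/negP => /subset_leq_card.
  by rewrite Ok cardB ?ltnn// ltnW.
have mh : m h <= m (b k).
  rewrite leNgt -[h](permKV b) mean_rank_lt; apply: contra hB => lk.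
  by rewrite -[h](permKV b); apply: imset_f; rewrite inE.
have hi : h != i by apply: contraTneq mh => ->; rewrite -ltNge.
have nmik : (m i < m (b k)) = false by rewrite ltNge ltW.
have := noerr h; rewrite /err_sign nmik (negbTE hi) expr0.
have := noerr i; rewrite /err_sign nmik eqxx expr1.
have := imin h hO; have := mean_gap hi; rewrite distrC.
rewrite ger0_norm; last by rewrite subr_ge0 ltW// (le_lt_trans mh).
lra.
Qed.

End Ranks.

(** * Selections along one sample path *)

Section Regret.
Context (R : realType) (d : measure_display) (Om : measurableType d)
  (Pr : probability Om R) (M N : nat) (hM : (0 < M)%N) (hMN : (M <= N)%N)
  (Pm : 'M[R]_M) (lam : 'I_M -> R) (u : 'I_M -> 'cV[R]_M)
  (hspec : consensus_spectrum Pm lam u) (P0 : forall k l, 0 <= Pm k l)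
  (sigma gamma eta : R) (hsigma : 0 < sigma) (hgamma : 1 < gamma)
  (heta : 0 < eta < 4)
  (f : R -> R) (hf : increasing_sublogarithmic f)
  (hrange : forall k : 'I_M, (f @` [set` `[1%R, +oo[]) (eps_c lam u k))
  (m : 'I_N -> R) (b : 'S_N) (hb : ranks_arms m b)
  (r : 'I_N -> 'I_M -> nat -> {RV Pr >-> R})
  (sel : 'I_M -> nat -> Om -> 'I_N)
  (halg : forall w : Om, coop_UCB2_selective sigma gamma eta f Pm
      (fun k t => sel k t w) (fun i k t => r i k t w)).

Let en := eps_n lam.
Let ec := eps_c lam u.

Let en0 : 0 <= en. Proof. exact: eps_n_ge0 hspec. Qed.
Let ec0 k : 0 <= ec k. Proof. exact: eps_c_ge0 hspec k. Qed.
Let M0 : 0 < M%:R :> R. Proof. by rewrite ltr0n. Qed.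

Definition rank_arm (k : 'I_M) : 'I_N := widen_ord hMN k.

(** The deterministic lower end of the range of (nhat + f(s)) / M. *)
Definition first_scale (k : 'I_M) (s : nat) : R :=
  (1 - Num.min (Num.sqrt (ec k)) en + f s%:R) / M%:R.

Definition cell_number (s : nat) : nat := cells eta ((s%:R + 1) * (1 + en)).

Definition cell_tilt (k : 'I_M) (i h : 'I_N) (s p : nat) : Om -> R :=
  let B := err_sign m b (rank_arm k) i h *
    peel_beta sigma gamma eta (ln s%:R) (cell_center eta (first_scale k s) p) in
  tilt sigma (m h) (selects R sel h) (reward r h)
    (fun j l => B * wt lam u (s - j) k l) s.

(** An upper bound, of small expectation, for the indicator that agent k
    selects the wrong arm i at time s + 1 by an estimation error. *)
Definition error_bound (k : 'I_M) (i : 'I_N) (s : nat) (w : Om) : R :=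
  \sum_(h < N) \sum_(p < cell_number s) decay gamma s * cell_tilt k i h s p w.

Section Path.
Variable w : Om.

Let x (h : 'I_N) (s : nat) (l : 'I_M) : R := selects R sel h s l w.
Let n (h : 'I_N) (s : nat) (k : 'I_M) : R := nhat Pm (fun k t => sel k t w) h s k 0.

Let x01 h s l : 0 <= x h s l <= 1.
Proof. by rewrite /x /selects ler0n lern1 leq_b1. Qed.

Let x0 h s l : 0 <= x h s l. Proof. by case/andP: (x01 h s l). Qed.

Let nE h s k : n h s k = wsum lam u (x h) k s.
Proof. by rewrite /n (nhat_wsum hspec). Qed.

Lemma round_robin k s (h : 'I_N) : (s < N)%N ->
  (sel k s.+1 w == h) = (s == rr_time h k).
Proof.
move=> sN; have := halg w k (ltn0Sn s); rewrite sN/= => e.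
by rewrite -rr_timeP// -e.
Qed.

Let x_rr (k : 'I_M) h : x h (rr_time h k) k = 1.
Proof.
by rewrite /x /selects round_robin ?eqxx// rr_time_lt.
Qed.

Let count h s : R := \sum_(j < s) \sum_l x h j l.

Let count_ge h s : (N <= s)%N -> M%:R <= count h s.
Proof.
move=> Ns; rewrite /count exchange_big/= -[M in leLHS]card_ord -sumr_const.
apply: ler_sum => l _.
have lt : (rr_time h l < s)%N by apply: leq_trans Ns; rewrite rr_time_lt.
rewrite (bigD1 (Ordinal lt))//= x_rr lerDl.
by apply: sumr_ge0.
Qed.

Let n_ge_count h s k : M%:R^-1 * count h s - en <= n h s k.
Proof. by rewrite nE; apply: (wsum_ge_mean hspec hM). Qed.

Let n_ge_en h s k : (N <= s)%N -> 1 - en <= n h s k.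
Proof.
move=> Ns; apply: le_trans (n_ge_count h s k); rewrite lerD2r.
by rewrite mulrC ler_pdivlMr// mul1r count_ge.
Qed.

Let n_ge_ec h s k : (N <= s)%N -> 1 - Num.sqrt (ec k) <= n h s k.
Proof.
move=> Ns; rewrite nE.
have lt l : (rr_time h l < s)%N by apply: leq_trans Ns; rewrite rr_time_lt.
apply: (wsum_ge_distinct hspec hM P0 k (tau := fun l => Ordinal (lt l))) => //.
- by move=> a c [] e; apply: rr_time_inj e.
- by move=> l; exact: x_rr.
Qed.

Let n_le h s k : n h s k <= s%:R.
Proof. by rewrite nE; apply: (wsum_le hspec hM P0). Qed.

Let n_gt0 h s k : (N + M.*2 <= s)%N -> 0 < n h s k.
Proof.
move=> Ns; rewrite nE /wsum.
have lt : (rr_time h k < s)%N.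
  by apply: leq_trans Ns; apply: ltn_addr; rewrite rr_time_lt.
rewrite (bigD1 (Ordinal lt))//= (bigD1 k)//= x_rr mulr1 -addrA ltr_pwDl//.
  apply: (wt_gt0 hspec hM P0); have := rr_time_lt h k; lia.
rewrite addr_ge0// ?sumr_ge0// => j _; first by rewrite mulr_ge0// (wt_ge0 hspec).
by apply: sumr_ge0 => l _; rewrite mulr_ge0// (wt_ge0 hspec).
Qed.

Let S h s k : R := shat Pm (fun k t => sel k t w) (fun i k t => r i k t w) h s k 0.

Let tilt_path B k h s :
  tilt sigma (m h) (selects R sel h) (reward r h)
    (fun j l => B * wt lam u (s - j) k l) s w
  = expR (B * (S h s k - m h * n h s k)
          - sigma ^+ 2 * B ^+ 2 / 2 * wsqsum lam u (x h) k s).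
Proof.
congr expR; rewrite /S (shat_wsum hspec) nE /wsum /wsqsum !mulr_sumr -sumrB.
rewrite mulr_sumr -sumrB; apply: eq_bigr => j _.
rewrite !mulr_sumr -sumrB mulr_sumr -sumrB; apply: eq_bigr => l _.
by rewrite /x /selects /reward; ring.
Qed.

(** Multiplying the error of the mean by nhat turns it into the deviation of the
    weighted reward sum at the threshold required by [peeling]. *)
Lemma error_certified k i h s : (N <= s)%N -> (0 < s)%N ->
  ec k <= f s%:R -> 0 < n h s k ->
  conf_width sigma gamma eta f Pm (fun k t => sel k t w) h k s
  <= err_sign m b (rank_arm k) i h *
     (muhat Pm (fun k t => sel k t w) (fun i k t => r i k t w) h k s - m h) ->
  1 <= \sum_(p < cell_number s) decay gamma s * cell_tilt k i h s p w.
Proof.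
move=> Ns s0 ecf np herr; set sg := err_sign _ _ _ _ _ in herr *.
have sg2 : sg ^+ 2 = 1 by rewrite sqrr_sign.
have l0 : 0 <= ln s%:R :> R by rewrite ln_ge0// ler1n.
have s0' : 0 <= s%:R :> R by [].
have [y00 hY] := count_range en0 (ec0 k) ecf s0'
  (n_le h s k) (n_ge_en h k Ns) (n_ge_ec h k Ns).
have f0 : 0 <= f s%:R by exact: le_trans ecf.
set y0 := 1 - _ + _ in y00 hY.
pose Y := (n h s k + f s%:R) / M%:R.
have hY' : y0 / M%:R <= Y <= y0 / M%:R * ((s%:R + 1) * (1 + en)).
  rewrite /Y ler_pM2r ?invr_gt0// mulrAC ler_pM2r ?invr_gt0//.
have y0' : 0 < y0 / M%:R by rewrite divr_gt0.
have VY : wsqsum lam u (x h) k s <= Y.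
  apply: le_trans (wsqsum_le hspec hM k s (x01 h)) _.
  by rewrite -nE /Y ler_pM2r ?invr_gt0// lerD2l.
have hS : sigma * Num.sqrt (2 * gamma / G eta * ln s%:R * Y)
    <= sg * (S h s k - m h * n h s k).
  pose mu := muhat Pm (fun k t => sel k t w) (fun i k t => r i k t w) h k s.
  have -> : sg * (S h s k - m h * n h s k) = sg * (mu - m h) * n h s k.
    by rewrite /mu /muhat -/(S h s k) -/(n h s k); field; rewrite gt_eqF.
  apply: le_trans (ler_wpM2r (ltW np) herr).
  rewrite /conf_width /= -/(n h s k) -[leRHS]mulrA ler_wpM2l ?(ltW hsigma)//.
  set A := (X in _ <= Num.sqrt X * _).
  have -> : Num.sqrt A * n h s k = Num.sqrt (n h s k ^+ 2 * A).
    by rewrite (sqrtrM _ (sqr_ge0 (n h s k))) sqrtr_sqr gtr0_norm// mulrC.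
  rewrite /A; apply: ler_wsqrtr; rewrite le_eqVlt; apply/orP; left; apply/eqP.
  by rewrite /Y; field; rewrite !gt_eqF// G_gt0.
have := peeling hsigma hgamma heta l0 y0' hY' VY hS.
congr (_ <= _); apply: eq_bigr => p _; rewrite /cell_tilt tilt_path -/sg.
rewrite /decay -/(first_scale k s); set B := peel_beta _ _ _ _ _.
have -> : (sg * B) ^+ 2 = B ^+ 2 by rewrite exprMn sg2 mul1r.
by rewrite [B * (sg * _)]mulrA [B * sg]mulrC.
Qed.

Lemma error_bound_ge0 k i s : 0 <= error_bound k i s w.
Proof.
by apply: sumr_ge0 => h _; apply: sumr_ge0 => p _; rewrite mulr_ge0 ?expR_ge0.
Qed.

Context (T : nat) (hT : (1 < T)%N) (i : 'I_N).
Let D := Delta_min m.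
Let X := leading_term M T sigma gamma eta D f + M%:R * en.

(** The hypotheses exclude every other charge: nhat is positive, f(s) dominates
    eps_c, and the width of i is at most Delta_min / 2. *)
Lemma late_selection k s : (1 < N)%N -> i != b (rank_arm k) -> (s < T)%N ->
  (N + M.*2 <= s)%N -> f_inv f (ec k) <= s%:R -> X <= count i s ->
  sel k s.+1 w = i -> 1 <= error_bound k i s w.
Proof.
move=> N1 ik sT Ns ts Xc seli.
have [t1 ft] := f_inv_spec hf (hrange k).
have NN : (N <= s)%N by apply: leq_trans Ns; rewrite leq_addr.
have s0 : (0 < s)%N by apply: leq_trans NN; exact: ltnW.
have s1 : 1 <= s%:R :> R by rewrite ler1n.
have ecf : ec k <= f s%:R by rewrite /ec -ft; apply: (increasing_le hf).
have f0 : 0 <= f s%:R by exact: le_trans ecf.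
have D0 : 0 < D by exact: Delta_min_gt0 hb N1.
have := halg w k (ltn0Sn s); rewrite ltnNge NN/= => -[A [Atop Amin]].
have C2 : 2 * conf_width sigma gamma eta f Pm (fun k t => sel k t w) i k s <= D.
  rewrite /conf_width; apply: (width_le hM hT) => //.
  - by rewrite ln_ge0//= ler_ln ?posrE ?ltr0n// ?ler_nat// ltnW// (ltn_trans s0).
  - apply/andP; split; first exact: f0.
    by apply: (increasing_le hf) => //; rewrite ler_nat ltnW.
  - exact: n_gt0.
  apply: le_trans (n_ge_count i s k); rewrite lerBrDr [leRHS]mulrC ler_pdivlMr//.
  by rewrite mulrDl divfK ?gt_eqF// [en * _]mulrC.
rewrite seli in Amin.
have [h herr] := selection_error
  (mu := fun h => muhat Pm (fun k t => sel k t w) (fun i k t => r i k t w) h k s)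
  (C := fun h => conf_width sigma gamma eta f Pm (fun k t => sel k t w) h k s)
  hb ik C2 Atop Amin.
have /le_trans := error_certified NN s0 ecf (n_gt0 h k Ns) herr.
apply; rewrite /error_bound (bigD1 h)//= lerDl.
apply: sumr_ge0 => h' _; apply: sumr_ge0 => p _.
by rewrite mulr_ge0 ?expR_ge0.
Qed.

Let sum_rr_le1 c : \sum_(s < T) (s == c :> nat)%:R <= 1 :> R.
Proof.
have [cT|cT] := ltnP c T.
  rewrite (bigD1 (Ordinal cT))//= eqxx big1 ?addr0// => j.
  by rewrite -val_eqE/= => /negbTE ->.
rewrite big1// => j _; rewrite (_ : (_ == _) = false)//.
by apply/negbTE; rewrite neq_ltn (leq_trans (ltn_ord j) cT).
Qed.

Let sum_window_le A : \sum_(s < T) ((N <= s) && (s < N + A))%N%:R <= A%:R :> R.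
Proof.
rewrite -natr_sum ler_nat.
suff -> : (\sum_(s < T) ((N <= s) && (s < N + A)) = minn (T - N) A)%N.
  by rewrite geq_minr.
elim: (T) => [|t IH]; first by rewrite big_ord0 sub0n min0n.
by rewrite big_ord_recr/= IH; lia.
Qed.

Let sum_from2 (F : nat -> R) :
  \sum_(s < T) (1 < s)%N%:R * F s = \sum_(1 <= s < T.-1) F s.+1.
Proof.
rewrite -(big_mkord xpredT (fun s => (1 < s)%N%:R * F s)).
rewrite (big_cat_nat (n := 2))//= big_nat_recl// big_nat1 !mul0r !add0r.
rewrite -(big_add1 _ _ 1 T xpredT F); apply: eq_big_nat => s /andP[s1 _].
by rewrite s1 mul1r.
Qed.

Let wrong_arm (k : 'I_M) : k.+1 != target_agent M b i -> i != b (rank_arm k).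
Proof.
apply: contraNneq => ->; rewrite /target_agent.
rewrite (_ : b (rank_arm k) \in best_arms b M); first by rewrite permK.
by apply: imset_f; rewrite inE /= ltn_ord.
Qed.

Let nbar_le k : (nbar b (fun k t => sel k t w) i k T)%:R <= \sum_(s < T) x i s k.
Proof.
rewrite /x /selects -natr_sum ler_nat /nbar big_add1/= big_mkord.
rewrite big_mkcond/=; apply: leq_sum => s _; by case: ifP.
Qed.

Let X0 : 0 <= X.
Proof.
apply: addr_ge0; last by rewrite mulr_ge0.
by apply: leading_term_ge0 => //; [exact: ltW|exact: le_trans (ltW hgamma)].
Qed.

Let agent_bound (k : 'I_M) : (1 < N)%N -> k.+1 != target_agent M b i ->
  \sum_(s < T) x i s k <= 1 + M.*2%:R + f_inv f (ec k)
    + \sum_(s < T) x i s k * (count i s < X)%R%:R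
    + \sum_(1 <= s < T.-1) error_bound k i s.+1 w.
Proof.
move=> N1 /wrong_arm ik; rewrite -(sum_from2 (fun s => error_bound k i s w)).
have [t1 _] := f_inv_spec hf (hrange k).
have t0 : 0 <= f_inv f (ec k) by apply: le_trans t1.
apply: (@le_trans _ _ (\sum_(s < T) (s == rr_time i k :> nat)%:R
  + \sum_(s < T) ((N <= s) && (s < N + M.*2))%N%:R
  + \sum_(s < T) ((0 < s)%N && (s%:R < f_inv f (ec k)))%:R
  + \sum_(s < T) x i s k * (count i s < X)%R%:R
  + \sum_(s < T) (1 < s)%N%:R * error_bound k i s w)); last first.
  by rewrite !lerD2r !lerD// ?count_below_le.
rewrite -!big_split/=; apply: ler_sum => s _.
have e0 : 0 <= (1 < s)%N%:R * error_bound k i s w by rewrite mulr_ge0// error_bound_ge0.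
have c0 : 0 <= x i s k * (count i s < X)%R%:R by rewrite mulr_ge0.
have [_ x1] := andP (x01 i s k).
have sum5 (y a1 a2 a3 a4 a5 : R) : 0 <= a1 -> 0 <= a2 -> 0 <= a3 -> 0 <= a4 ->
    0 <= a5 -> [\/ y <= a1, y <= a2, y <= a3 | y <= a4 \/ y <= a5] ->
    y <= a1 + a2 + a3 + a4 + a5.
  by move=> ? ? ? ? ? [|||[]] ?; lra.
apply: sum5 => //.
have [sN|Ns] := ltnP s N; first by apply: Or41; rewrite {1}/x /selects round_robin.
have s0 : (0 < s)%N by apply: leq_trans Ns; exact: ltnW.
have s1 : (1 < s)%N by exact: leq_trans Ns.
have [sM|Ms] := ltnP s (N + M.*2); first by apply: Or42.
have [st|ts] := ltP s%:R (f_inv f (ec k)); first by apply: Or43; rewrite s0.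
apply: Or44; have [cX|Xc] := ltP (count i s) X; first by left; rewrite mulr1.
right; rewrite s1 mul1r {1}/x /selects; case: eqP => [seli|_].
  exact: late_selection Xc seli.
exact: error_bound_ge0.
Qed.

(** Per agent: one selection in the round robin, 2 M steps, and at most
    f^-1(eps_c) early steps; over all agents: X + M selections while the arm
    has been selected fewer than X times, and the error bounds. *)
Lemma path_bound : (1 < N)%N ->
  \sum_(k < M | k.+1 != target_agent M b i)
    (nbar b (fun k t => sel k t w) i k T)%:R
  <= M%:R * (1 + M.*2%:R) + \sum_k f_inv f (ec k) + (X + M%:R)
     + \sum_k \sum_(1 <= s < T.-1) error_bound k i s.+1 w.
Proof.
move=> N1; apply: (@le_trans _ _ (\sum_k (1 + M.*2%:R + f_inv f (ec k)
    + \sum_(s < T) x i s k * (count i s < X)%R%:R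
    + \sum_(1 <= s < T.-1) error_bound k i s.+1 w))).
  rewrite big_mkcond/=; apply: ler_sum => k _; case: ifP => [hk|_].
    by apply: le_trans (nbar_le k) _; exact: agent_bound.
  have [t1 _] := f_inv_spec hf (hrange k).
  rewrite !addr_ge0//; first by apply: le_trans t1.
    by apply: sumr_ge0 => s _; rewrite mulr_ge0.
  by apply: sumr_ge0 => s _; rewrite error_bound_ge0.
rewrite !big_split/= lerD2r !sumr_const card_ord mulrDr mulr1.
rewrite -[M.*2%:R *+ M]mulr_natl lerD2l exchange_big/=.
have a01 s : 0 <= \sum_k x i s k <= M%:R.
  apply/andP; split; first exact: sumr_ge0.
  rewrite -[M in leRHS]card_ord -sumr_const; apply: ler_sum => k _.
  by have /andP[] := x01 i s k.
apply: le_trans (sum_capped_le T X0 a01).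
by apply: ler_sum => s _; rewrite mulr_suml.
Qed.

End Path.
End Regret.

(** * The expected number of incorrect selections *)

Section ExpectedError.
Context (R : realType) (d : measure_display) (Om : measurableType d)
  (Pr : probability Om R) (M N : nat) (hMN : (M <= N)%N)
  (lam : 'I_M -> R) (u : 'I_M -> 'cV[R]_M) (sigma gamma eta : R)
  (f : R -> R) (m : 'I_N -> R) (b : 'S_N)
  (r : 'I_N -> 'I_M -> nat -> {RV Pr >-> R})
  (sel : 'I_M -> nat -> Om -> 'I_N)
  (hsel : forall k t i, (0 < t)%N -> measurable (sel k t @^-1` [set i]))
  (hr : reward_model sigma m r sel).

Let err := error_bound hMN lam u sigma gamma eta f m b r sel.

Let mtilt k i h s p :
  measurable_fun setT (cell_tilt hMN lam u sigma gamma eta f m b r sel k i h s p).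
Proof.
apply: measurable_tilt => j l _; first exact: measurable_selects.
exact: measurable_reward.
Qed.

Lemma measurable_error_bound k i s : measurable_fun setT (err k i s).
Proof.
apply: measurable_sum => h; apply: measurable_sum => p.
by apply: measurable_funM.
Qed.

Lemma integral_error_bound_le k i s :
  (\int[Pr]_w (err k i s w)%:E
   <= (N%:R * ((cell_number lam eta s)%:R * decay gamma s))%:E)%E.
Proof.
under eq_integral do rewrite -sumEFin.
rewrite ge0_integral_sum//; last 2 first.
- move=> h; apply/measurable_EFinP; apply: measurable_sum => p.
  by apply: measurable_funM.
- move=> h w _; rewrite lee_fin; apply: sumr_ge0 => p _.
  by rewrite mulr_ge0 ?expR_ge0.
rewrite -[N in leRHS]card_ord mulr_natl -sumr_const -sumEFin.
apply: lee_sum => h _.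
under eq_integral do rewrite -sumEFin.
rewrite ge0_integral_sum//; last 2 first.
- by move=> p; apply/measurable_EFinP; apply: measurable_funM.
- by move=> p w _; rewrite lee_fin mulr_ge0 ?expR_ge0.
rewrite -[cell_number _ _ _ in leRHS]card_ord mulr_natl -sumr_const -sumEFin.
apply: lee_sum => p _.
under eq_integral do rewrite EFinM.
rewrite ge0_integralZl_EFin ?decay_ge0//.
- rewrite -[leRHS]mule1; apply: lee_wpmul2l; first by rewrite lee_fin decay_ge0.
  exact: (integral_tilt_le1 hsel hr).
- by move=> w _; rewrite lee_fin expR_ge0.
- by apply/measurable_EFinP; exact: mtilt.
Qed.

Lemma measurable_nbar i k T :
  measurable_fun setT (fun w => (nbar b (fun k t => sel k t w) i k T)%:R : R).
Proof.
rewrite (_ : (fun w => _) = (fun w => \sum_(s < T)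
    if incorrect b k i then selects R sel i s k w else 0)).
  apply: measurable_sum => s; case: (incorrect b k i) => //.
  exact: measurable_selects.
apply/funext => w; rewrite /nbar big_add1/= big_mkord big_mkcond/= natr_sum.
by apply: eq_bigr => s _; case: ifP.
Qed.

End ExpectedError.

Lemma expected_error_series (R : realType) (M : nat) (lam : 'I_M -> R)
    (gamma eta : R) (T : nat) : 1 < gamma -> 0 < eta < 4 -> 0 <= eps_n lam ->
  \sum_(1 <= s < T) (cell_number lam eta s.+1)%:R * decay gamma s.+1
  <= (2 / (gamma - 1) ^+ 2 + 1
      + ln ((1 + eps_n lam) * (1 + eta)) / (gamma - 1)) / ln (1 + eta).
Proof.
move=> g1 heta en0; have /andP[eta0 _] := heta.
have L0 : 0 < ln (1 + eta) by rewrite ln_gt0// ltrDl.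
have e1 : 0 < 1 + eps_n lam by rewrite ltr_wpDr.
have e2 : 0 < 1 + eta by rewrite addr_gt0.
have c0 : 0 <= ln ((1 + eps_n lam) * (1 + eta)).
  by rewrite lnM ?posrE// addr_ge0 ?(ltW L0)// ln_ge0// lerDl.
have a0 : 0 < gamma - 1 by rewrite subr_gt0.
apply: le_trans (weighted_series_le T a0 L0 c0).
apply: ler_sum_nat => s /andP[s1 _].
have -> : 1 + (gamma - 1) = gamma by rewrite addrC subrK.
rewrite ler_wpM2r ?decay_ge0//.
have s0 : 0 < s.+2%:R :> R by rewrite ltr0n.
rewrite /cell_number natr1; apply: le_trans (cells_le heta _) _.
  by rewrite mulr_ege1 ?ler1n// lerDl.
by rewrite !lnM ?posrE// addrA.
Qed.

Lemma single_arm_target (M N : nat) (b : 'S_N) (k : 'I_M) (i : 'I_N) :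
  (M <= N)%N -> (N <= 1)%N -> target_agent M b i = k.+1.
Proof.
move=> MN N1; have kM := ltn_ord k.
have j0 (j : 'I_N) : nat_of_ord j = 0%N by have := ltn_ord j; lia.
have k0 : nat_of_ord k = 0%N by lia.
have iB : i \in best_arms b M.
  apply/imsetP; exists (b^-1%g i); last by rewrite permKV.
  by rewrite inE j0; lia.
by rewrite /target_agent iB k0 j0.
Qed.

Theorem theorem3 (R : realType) (d : measure_display) (Om : measurableType d)
  (Pr : probability Om R) (M N : nat) (hM : (0 < M)%N) (hMN : (M <= N)%N)
  (* communication graph *)
  (e : rel 'I_M) (he : simple_graph e) (hconn : connected_graph e)
  (kappa : R) (hkappa : 0 < kappa <= 1)
  (lam : 'I_M -> R) (u : 'I_M -> 'cV[R]_M)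
  (hspec : consensus_spectrum (consensus_matrix e kappa) lam u)
  (* parameters of the algorithm *)
  (sigma_g gamma eta : R) (hsigma : 0 < sigma_g) (hgamma : 1 < gamma)
  (heta : 0 < eta < 4)
  (f : R -> R) (hf : increasing_sublogarithmic f)
  (hrange : forall k : 'I_M, (f @` [set` `[1%R, +oo[]) (eps_c lam u k))
  (* arms, rewards and selections *)
  (m : 'I_N -> R) (b : 'S_N) (hb : ranks_arms m b)
  (r : 'I_N -> 'I_M -> nat -> {RV Pr >-> R})
  (sel : 'I_M -> nat -> Om -> 'I_N)
  (hsel : forall k t i, (0 < t)%N -> measurable (sel k t @^-1` [set i]))
  (hr : reward_model sigma_g m r sel)
  (halg : forall w : Om,
    coop_UCB2_selective sigma_g gamma eta f (consensus_matrix e kappa)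
      (fun k t => sel k t w) (fun i k t => r i k t w)) :
  forall (i : 'I_N) (T : nat), (1 < T)%N ->
  (\sum_(k < M | k.+1 != target_agent M b i)
     'E_Pr[fun w => (nbar b (fun k t => sel k t w) i k T)%:R]
   <= (leading_term M T sigma_g gamma eta (Delta_min m) f
       + Lbar N gamma eta f (eps_n lam) (eps_c lam u))%:E)%E.
Proof.
move=> i T hT.
have P0 := consensus_matrix_ge0 he hkappa.
have en0 : 0 <= eps_n lam by exact: eps_n_ge0 hspec.
have /andP[eta0 _] := heta.
have a0 : 0 < gamma - 1 by rewrite subr_gt0.
have L0 : 0 < ln (1 + eta) by rewrite ln_gt0// ltrDl.
have t1 k : 1 <= f_inv f (eps_c lam u k) by have [] := f_inv_spec hf (hrange k).
have Lc : ln (1 + eta) <= ln ((1 + eps_n lam) * (1 + eta)).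
  have e1 : 0 < 1 + eps_n lam by rewrite ltr_wpDr.
  have e2 : 0 < 1 + eta by rewrite addr_gt0.
  by rewrite lnM ?posrE// lerDr ln_ge0// lerDl.
set c := ln (_ * _) in Lc.
set lead := leading_term _ _ _ _ _ _ _.
have lead0 : 0 <= lead.
  by apply: leading_term_ge0 => //; [exact: ltW|exact: le_trans (ltW hgamma)].
have c_ge0 : 0 <= c by apply: le_trans (ltW L0) Lc.
have [N1|N1] := leqP N 1.
  (* a single arm, a single agent: no selection is incorrect *)
  rewrite big_pred0 => [|k]; last by rewrite (single_arm_target b k i hMN N1) eqxx.
  rewrite lee_fin; apply: addr_ge0 => //; rewrite /Lbar -/c.
  have g0 : 0 <= gamma by rewrite ltW// (lt_trans ltr01).
  apply: addr_ge0; first apply: addr_ge0 => //; first apply: addr_ge0.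
  - by apply: sumr_ge0 => k _; rewrite subr_ge0.
  - by rewrite mulr_ge0// addr_ge0.
  - apply: mulr_ge0; first by rewrite divr_ge0 ?(ltW L0)// !mulr_ge0.
    apply: addr_ge0 => //; apply: addr_ge0; first by rewrite divr_ge0// sqr_ge0.
    by rewrite divr_ge0 ?(ltW a0)// mulr_ge0.
pose err k w := \sum_(1 <= s < T.-1)
  error_bound hMN lam u sigma_g gamma eta f m b r sel k i s.+1 w.
set X := lead + M%:R * eps_n lam.
pose c0 := M%:R * (1 + M.*2%:R) + \sum_k f_inv f (eps_c lam u k) + (X + M%:R).
pose B : R := (2 / (gamma - 1) ^+ 2 + 1 + c / (gamma - 1)) / ln (1 + eta).
have path w :=
  path_bound hM hMN hspec P0 hsigma hgamma heta hf hrange hb halg w hT i N1.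
have Men0 : 0 <= M%:R * eps_n lam by rewrite mulr_ge0.
have c00 : 0 <= c0.
  rewrite /c0 /X; apply: addr_ge0; last first.
    by apply: addr_ge0 => //; exact: addr_ge0.
  apply: addr_ge0; first by rewrite mulr_ge0 ?addr_ge0.
  by apply: sumr_ge0 => k _; apply: le_trans (t1 k).
have merr k : measurable_fun setT (err k).
  by apply: measurable_sum => s; exact: measurable_error_bound.
have err0 k w : 0 <= err k w.
  by apply: sumr_ge0 => s _; exact: error_bound_ge0.
have Eerr k : (\int[Pr]_w (err k w)%:E <= (N%:R * B)%:E)%E.
  rewrite /err; under eq_integral do rewrite -sumEFin.
  rewrite ge0_integral_sum//; last 2 first.
  - by move=> s; apply/measurable_EFinP; exact: measurable_error_bound.
  - by move=> s w _; rewrite lee_fin error_bound_ge0.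
  apply: (@le_trans _ _ (\sum_(1 <= s < T.-1)
     (N%:R * ((cell_number lam eta s.+1)%:R * decay gamma s.+1))%:E)%E).
    by apply: lee_sum => s _; exact: integral_error_bound_le.
  rewrite sumEFin lee_fin -mulr_sumr ler_wpM2l//.
  exact: expected_error_series.
have -> : (\sum_(k < M | k.+1 != target_agent M b i)
     'E_Pr[fun w => (nbar b (fun k t => sel k t w) i k T)%:R]
   = \int[Pr]_w (\sum_(k < M | k.+1 != target_agent M b i)
       (nbar b (fun k t => sel k t w) i k T)%:R)%:E)%E.
  under eq_integral do rewrite -sumEFin -big_filter.
  rewrite ge0_integral_sum//; last by move=> k; exact/measurable_EFinP/measurable_nbar.
  by rewrite big_filter; apply: eq_bigr => k _; rewrite unlock.
apply: (@le_trans _ _ (\int[Pr]_w (c0%:E + \sum_k (err k w)%:E))%E).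
  apply: ge0_le_integral => //.
  - by move=> w _; rewrite lee_fin sumr_ge0.
  - apply/measurable_EFinP; under eq_fun do rewrite -big_filter.
    by apply: measurable_sum => k; exact: measurable_nbar.
  - under eq_fun do rewrite sumEFin -EFinD.
    apply/measurable_EFinP; apply: measurable_funD => //.
    exact: measurable_sum.
  - by move=> w _; rewrite sumEFin -EFinD lee_fin; exact: path.
rewrite ge0_integralD//; last 2 first.
- by move=> w _; rewrite sumEFin lee_fin sumr_ge0.
- under eq_fun do rewrite sumEFin.
  by apply/measurable_EFinP; exact: measurable_sum.
rewrite integral_cst// ge0_integral_sum//; last 2 first.
- by move=> k; exact/measurable_EFinP.
- by move=> k w _; rewrite lee_fin.
apply: (@le_trans _ _ (c0%:E + \sum_(k < M) (N%:R * B)%:E)%E).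
  apply: leeD; last by apply: lee_sum.
  by rewrite -[leRHS]mule1 lee_wpmul2l ?lee_fin// probability_le1.
rewrite sumEFin -EFinD lee_fin sumr_const card_ord -[_ *+ M]mulr_natl.
rewrite /c0 /X /Lbar -/c sumrB sumr_const card_ord.
(* Everything is linear in v^2 l, q v, l and q. Since q >= 1, the summand
   2 M (N + 1) q outweighs the 2 M + 2 M^2 selections not covered so far. *)
pose l := (ln (1 + eta))^-1; have l0 : 0 <= l by rewrite invr_ge0 ltW.
pose q := c * l; have q1 : 1 <= q by rewrite ler_pdivlMr// mul1r.
pose v := (gamma - 1)^-1; have v0 : 0 <= v by rewrite invr_ge0 ltW.
have q0 : 0 <= q by exact: le_trans q1.
have -> : B = 2 * (v ^+ 2 * l) + l + q * v.
  by rewrite /B /q /l /v; field; rewrite !gt_eqF.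
have -> : 2 * M%:R * N.+1%:R / ln (1 + eta) *
    (1 / (gamma - 1) ^+ 2 + gamma * c / (gamma - 1) + 1)
  = 2 * M%:R * (N%:R + 1) * (v ^+ 2 * l + q + q * v + l).
  by rewrite -[N.+1%:R]natr1 /q /l /v; field; rewrite !gt_eqF.
have MN : M%:R <= N%:R :> R by rewrite ler_nat.
have Mp : 0 <= M%:R :> R by [].
have v2 : 0 <= v ^+ 2 * l by exact: mulr_ge0 (sqr_ge0 v) l0.
have qv : 0 <= q * v by exact: mulr_ge0 q0 v0.
rewrite -muln2 natrM; set y := v ^+ 2 * l in v2 *; set z := q * v in qv *.
set S := \sum_k _.
have hq : 0 <= M%:R * (N%:R + 1) * (q - 1) by rewrite !mulr_ge0 ?subr_ge0// addr_ge0.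
have hM2 : 0 <= M%:R * (N%:R - M%:R) :> R by rewrite mulr_ge0// subr_ge0.
have h1 : 0 <= M%:R * N%:R * l by rewrite !mulr_ge0.
have h2 : 0 <= M%:R * N%:R * z by rewrite !mulr_ge0.
have h3 : 0 <= M%:R * (y + z + l) by rewrite mulr_ge0 ?addr_ge0.
rewrite -[1 *+ M]/(M%:R); lra.
Qed.
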